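(* Let $k$ be a field of characteristic not $2$, let $G$ be a finite group acting linearly on a finite-dimensional $k$-vector space $V$, let $S=S(V)$, and let $\kappa: V\wedge V\to (k\oplus V)\otimes kG$ be a linear map. The algebra $\mathcal{H}_\kappa = T(V)\# G/(vw-wv-\kappa(v,w)\mid v,w\in V)$ is a Drinfeld orbifold algebra if and only if the following conditions hold for each $g\in G$ and all $v_1,v_2,v_3\in V$: (i) the parameter function $\kappa$ is $G$-invariant; (ii) $\displaystyle\sum_{\sigma\in \mathrm{Alt}_3}\kappa^L_g(v_{\sigma(2)},v_{\sigma(3)})\,(v_{\sigma(1)}-{}^g v_{\sigma(1)})=0$ in $S$; (iii) $\displaystyle\sum_{\sigma\in\mathrm{Alt}_3}\sum_{h\in G}\kappa^L_{gh^{-1}}\big(v_{\sigma(1)}+{}^h v_{\sigma(1)},\ \kappa^L_h(v_{\sigma(2)},v_{\sigma(3)})\big)=2\sum_{\sigma\in\mathrm{Alt}_3}\kappa^C_g(v_{\sigma(2)},v_{\sigma(3)})\,({}^g v_{\sigma(1)}-v_{\sigma(1)})$; (iv) $\displaystyle\sum_{\sigma\in\mathrm{Alt}_3}\sum_{h\in G}\kappa^C_{gh^{-1}}\big(v_{\sigma(1)}+{}^h v_{\sigma(1)},\ \kappa^L_h(v_{\sigma(2)},v_{\sigma(3)})\big)=0$.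
   Context: Write ${}^g v$ for the action of $g\in G$ on $v\in V$, extended to $S=S(V)$ and to the tensor algebra $T(V)$ by algebra automorphisms. For $A=S$ or $A=T(V)$, the skew group algebra $A\# G$ is $A\otimes kG$ with multiplication $(a\otimes g)(b\otimes h)=a\,({}^g b)\otimes gh$; tensor signs are omitted. Write $\kappa(v,w)=\kappa(v\wedge w)=\sum_{g\in G}\kappa_g(v,w)\,g$ with $\kappa_g: V\wedge V\to k\oplus V$, and decompose $\kappa_g=\kappa^C_g+\kappa^L_g$ with $\kappa^C_g:V\wedge V\to k$ and $\kappa^L_g: V\wedge V\to V$ (all regarded as alternating bilinear maps on $V\times V$). $\mathcal{H}_\kappa$ is filtered by assigning degree $1$ to each $v\in V$ and degree $0$ to each $g\in G$. It satisfies the PBW condition, and is then called a Drinfeld orbifold algebra, when its associated graded algebra is isomorphic (as a graded algebra) to $S\# G$; equivalently, when $\{v_1^{m_1}\cdots v_n^{m_n}g: m_i\in\mathbb{Z}_{\ge0},\ g\in G\}$ is a $k$-basis of $\mathcal{H}_\kappa$, where $v_1,\dots,v_n$ is a $k$-basis of $V$. $G$ acts on parameter functions by $({}^h\kappa)(v,w)={}^h\big(\kappa({}^{h^{-1}}v,{}^{h^{-1}}w)\big)=\sum_{g\in G}{}^h\big(\kappa_g({}^{h^{-1}}v,{}^{h^{-1}}w)\big)\,hgh^{-1}$; $\kappa$ is $G$-invariant if ${}^h\kappa=\kappa$ for all $h\in G$. $\mathrm{Alt}_3$ denotes the cyclic group of order $3$ inside the symmetric group on $\{1,2,3\}$. 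*)

(* Defs.v *)
Set Warnings "-notation-overridden,-ambiguous-paths,-notation-incompatible-prefix".
Set Warnings "-redundant-canonical-projection,-projection-no-head-constant".
From HB Require Import structures.
From mathcomp Require Import all_boot all_algebra all_fingroup all_solvable.
From mathcomp Require Import boolp.
From mathcomp Require Import finmap monalg mpoly.

Set Implicit Arguments.
Unset Strict Implicit.
Unset Printing Implicit Defensive.

Import GRing.Theory.
Local Open Scope ring_scope.
Local Open Scope quotient_scope.
Local Notation repr := generic_quotient.repr.

Section Submodules.
Variables (k : pzRingType) (V : lmodType k) (P : submodClosed V).

Record submodule : Type :=
  Submodule { submodule_val : V; _ : submodule_val \in P }.

HB.instance Definition _ := [isSub for submodule_val].
HB.instance Definition _ := [Choice of submodule by <:].
HB.instance Definition _ := [SubChoice_isSubLmodule of submodule by <:].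

Definition submodule_pred : {pred V} := P.

Fact submodule_pred_zmod : zmod_closed submodule_pred.
Proof.
rewrite /submodule_pred; split=> [|x y Px Py]; first exact: rpred0.
by rewrite -scaleN1r rpredD ?rpredZ.
Qed.
HB.instance Definition _ :=
  GRing.isZmodClosed.Build V submodule_pred submodule_pred_zmod.

Definition lquot : Type := Quotient.quot submodule_pred.

HB.instance Definition _ := EqQuotient.on lquot.
HB.instance Definition _ := Choice.on lquot.
HB.instance Definition _ := GRing.Zmodule.on lquot.
HB.instance Definition _ : isZmodQuotient _ _ _ _ _ lquot := ZmodQuotient.on lquot.

Lemma lquot_eqP (x y : V) : reflect (\pi_lquot x = \pi_lquot y) (x - y \in P).
Proof.
apply: (iffP idP) => [Pxy|/eqP].
  by apply/eqP; rewrite -[_ == _]Quotient.idealrBE.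
by rewrite -[_ == _]Quotient.idealrBE.
Qed.

Lemma lquot_piD (x y : V) : \pi_lquot (x + y) = \pi_lquot x + \pi_lquot y.
Proof. exact: (raddfD (\pi_lquot)). Qed.

Definition lquot_scale (a : k) (x : lquot) : lquot := \pi_lquot (a *: repr x).

Lemma lquot_piZ a (x : V) : \pi_lquot (a *: x) = lquot_scale a (\pi_lquot x).
Proof.
apply/lquot_eqP; rewrite -scalerBr rpredZ //.
by apply/lquot_eqP; rewrite reprK.
Qed.

Lemma lquotW (Q : lquot -> Prop) :
  (forall x : V, Q (\pi_lquot x)) -> forall x, Q x.
Proof. by move=> Qpi x; rewrite -[x]reprK. Qed.

Fact lquot_scaleA a b (x : lquot) :
  lquot_scale a (lquot_scale b x) = lquot_scale (a * b) x.
Proof.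
elim/lquotW: x => x.
by rewrite -(lquot_piZ b) -(lquot_piZ a) -(lquot_piZ (a * b)) scalerA.
Qed.

Fact lquot_scale1 : left_id 1 lquot_scale.
Proof. by elim/lquotW=> x; rewrite -lquot_piZ scale1r. Qed.

Fact lquot_scaleDr : right_distributive lquot_scale +%R.
Proof.
move=> a; elim/lquotW=> x; elim/lquotW=> y.
by rewrite -lquot_piD -3!(lquot_piZ a) -lquot_piD scalerDr.
Qed.

Fact lquot_scaleDl (x : lquot) : {morph lquot_scale^~ x : a b / a + b}.
Proof.
move=> a b /=; elim/lquotW: x => x.
by rewrite -(lquot_piZ a) -(lquot_piZ b) -(lquot_piZ (a + b)) -lquot_piD scalerDl.
Qed.

HB.instance Definition _ := GRing.Zmodule_isLmodule.Build k lquot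
  lquot_scaleA lquot_scale1 lquot_scaleDr lquot_scaleDl.

Lemma lquot_pi_linear : linear \pi_lquot.
Proof. by move=> a x y; rewrite lquot_piD lquot_piZ. Qed.

End Submodules.

Section QuotientAlgebra.
Variables (k : comNzRingType) (A : algType k).

Definition two_sided_ideal (I : A -> Prop) : Prop :=
  [/\ I 0, forall x y, I x -> I y -> I (x - y),
      forall a x, I x -> I (a * x) & forall a x, I x -> I (x * a)].

Variable gens : A -> Prop.

Definition ideal_gen : {pred A} := fun x =>
  `[< forall I, two_sided_ideal I -> (forall r, gens r -> I r) -> I x >].

Lemma ideal_genP x :
  reflect (forall I, two_sided_ideal I -> (forall r, gens r -> I r) -> I x)
          (x \in ideal_gen).
Proof. exact: asboolP. Qed.

Fact ideal_gen_submod : submod_closed ideal_gen.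
Proof.
split=> [|a x y /ideal_genP Ix /ideal_genP Iy]; apply/ideal_genP => I idI genI.
  by case: idI.
have [I0 IB Il _] := idI.
have -> : a *: x + y = a%:A * x - (0 - y) by rewrite mulr_algl sub0r opprK.
by apply: (IB); [apply: Il; apply: Ix | apply: (IB) => //; apply: Iy].
Qed.
HB.instance Definition _ := GRing.isSubmodClosed.Build k A ideal_gen ideal_gen_submod.

Lemma ideal_gen_mull a x : x \in ideal_gen -> a * x \in ideal_gen.
Proof.
move=> /ideal_genP Ix; apply/ideal_genP => I idI genI.
by case: (idI) => _ _ Il _; apply: Il; apply: Ix.
Qed.

Lemma ideal_gen_mulr a x : x \in ideal_gen -> x * a \in ideal_gen.
Proof.
move=> /ideal_genP Ix; apply/ideal_genP => I idI genI.
by case: (idI) => _ _ _ Ir; apply: Ir; apply: Ix.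
Qed.

Definition quot_alg : Type := lquot ideal_gen.
HB.instance Definition _ := EqQuotient.on quot_alg.
HB.instance Definition _ := GRing.Lmodule.on quot_alg.

Definition quot_alg_pi : A -> quot_alg := \pi_(lquot ideal_gen).
HB.instance Definition _ := GRing.isLinear.Build k A quot_alg _ quot_alg_pi
  (@lquot_pi_linear k A ideal_gen).

Definition quot_alg_one : quot_alg := quot_alg_pi 1.
Definition quot_alg_mul (x y : quot_alg) : quot_alg :=
  quot_alg_pi (repr x * repr y).

Lemma quot_alg_piM x y :
  quot_alg_pi (x * y) = quot_alg_mul (quot_alg_pi x) (quot_alg_pi y).
Proof.
rewrite /quot_alg_mul; set x' := repr _; set y' := repr _.
have Ix : x - x' \in ideal_gen by apply/lquot_eqP; rewrite reprK.
have Iy : y - y' \in ideal_gen by apply/lquot_eqP; rewrite reprK.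
apply/lquot_eqP.
have -> : x * y - x' * y' = (x - x') * y + x' * (y - y').
  by rewrite mulrBl mulrBr addrA subrK.
by apply: rpredD; [apply: ideal_gen_mulr | apply: ideal_gen_mull].
Qed.

Lemma quot_algW (Q : quot_alg -> Prop) :
  (forall x, Q (quot_alg_pi x)) -> forall x, Q x.
Proof. exact: lquotW. Qed.

Fact quot_alg_mulA : associative quot_alg_mul.
Proof.
elim/quot_algW=> x; elim/quot_algW=> y; elim/quot_algW=> z.
by rewrite -(quot_alg_piM y z) -(quot_alg_piM x y) -!quot_alg_piM mulrA.
Qed.
Fact quot_alg_mul1l : left_id quot_alg_one quot_alg_mul.
Proof. by elim/quot_algW=> x; rewrite -quot_alg_piM mul1r. Qed.
Fact quot_alg_mul1r : right_id quot_alg_one quot_alg_mul.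
Proof. by elim/quot_algW=> x; rewrite -quot_alg_piM mulr1. Qed.
Fact quot_alg_mulDl : left_distributive quot_alg_mul +%R.
Proof.
elim/quot_algW=> x; elim/quot_algW=> y; elim/quot_algW=> z.
rewrite -(quot_alg_piM x z) -(quot_alg_piM y z) -!linearD.
by rewrite -quot_alg_piM mulrDl.
Qed.
Fact quot_alg_mulDr : right_distributive quot_alg_mul +%R.
Proof.
elim/quot_algW=> x; elim/quot_algW=> y; elim/quot_algW=> z.
rewrite -(quot_alg_piM x y) -(quot_alg_piM x z) -!linearD.
by rewrite -quot_alg_piM mulrDr.
Qed.
(* The quotient may be the zero ring, hence only a pzRing. *)
HB.instance Definition _ := GRing.Zmodule_isPzRing.Build quot_alg
  quot_alg_mulA quot_alg_mul1l quot_alg_mul1r quot_alg_mulDl quot_alg_mulDr.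

Fact quot_alg_pi_monoid : monoid_morphism quot_alg_pi.
Proof. by split=> // x y; apply: quot_alg_piM. Qed.
HB.instance Definition _ :=
  GRing.isMonoidMorphism.Build A quot_alg quot_alg_pi quot_alg_pi_monoid.

Lemma quot_alg_scaleAl (a : k) (x y : quot_alg) : a *: (x * y) = (a *: x) * y.
Proof.
elim/quot_algW: x => x; elim/quot_algW: y => y.
by rewrite -rmorphM -!linearZ -rmorphM /= scalerAl.
Qed.

Lemma quot_alg_scaleAr (a : k) (x y : quot_alg) : a *: (x * y) = x * (a *: y).
Proof.
elim/quot_algW: x => x; elim/quot_algW: y => y.
by rewrite -rmorphM -!linearZ -rmorphM /= scalerAr.
Qed.

End QuotientAlgebra.

Section SkewGroupAlgebra.
Variables (k : comNzRingType) (gT : finGroupType).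

Record lin_action (V : lmodType k) := LinAction {
  lin_act :> gT -> {linear V -> V};
  lin_act1 : forall v, lin_act 1%g v = v;
  lin_actM : forall g h v, lin_act (g * h)%g v = lin_act g (lin_act h v) }.

Record alg_action (A : algType k) := AlgAction {
  alg_act :> gT -> {lrmorphism A -> A};
  alg_act1 : forall a, alg_act 1%g a = a;
  alg_actM : forall g h a, alg_act (g * h)%g a = alg_act g (alg_act h a) }.

(* An element x of A # G stands for the sum over g of x g # g. The argument act
   does not occur in the carrier; it selects the multiplication. *)
Definition skew_alg (A : algType k) (act : alg_action A) : Type :=
  {ffun gT -> A}.

Variables (A : algType k) (act : alg_action A).

Local Notation skew := (skew_alg act).
HB.instance Definition _ := GRing.Lmodule.on skew.

Definition skew_tensor (a : A) (g : gT) : skew :=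
  [ffun h => if h == g then a else 0].

Definition skew_one : skew := skew_tensor 1 1%g.
Definition skew_mul (x y : skew) : skew :=
  [ffun g => \sum_h x h * act h (y (h^-1 * g)%g)].

Fact skew_mulA : associative skew_mul.
Proof.
move=> x y z; apply/ffunP=> g; rewrite !ffunE.
under eq_bigr => h _ do rewrite ffunE linear_sum mulr_sumr.
under [RHS]eq_bigr => h _ do rewrite ffunE mulr_suml.
rewrite [RHS]exchange_big; apply: eq_bigr => h _ /=.
rewrite [RHS](reindex_inj (mulgI h)); apply: eq_bigr => j _ /=.
by rewrite rmorphM mulrA mulKg [in RHS]alg_actM invMg mulgA.
Qed.
Fact skew_mul1l : left_id skew_one skew_mul.
Proof.
move=> x; apply/ffunP=> g; rewrite ffunE (bigD1 1%g) //= ffunE eqxx mul1r.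
rewrite alg_act1 invg1 mul1g big1 ?addr0 // => h /negPf h1.
by rewrite ffunE h1 mul0r.
Qed.
Fact skew_mul1r : right_id skew_one skew_mul.
Proof.
move=> x; apply/ffunP=> g; rewrite ffunE (bigD1 g) //= ffunE mulVg eqxx.
rewrite rmorph1 mulr1 big1 ?addr0 // => h /negPf hg.
by rewrite ffunE -eq_mulVg1 hg rmorph0 mulr0.
Qed.
Fact skew_mulDl : left_distributive skew_mul +%R.
Proof.
move=> x y z; apply/ffunP=> g; rewrite !ffunE -big_split /=.
by apply: eq_bigr => h _; rewrite ffunE mulrDl.
Qed.
Fact skew_mulDr : right_distributive skew_mul +%R.
Proof.
move=> x y z; apply/ffunP=> g; rewrite !ffunE -big_split /=.
by apply: eq_bigr => h _; rewrite ffunE rmorphD mulrDr.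
Qed.
Fact skew_one_neq0 : skew_one != 0.
Proof. by apply/eqP=> /ffunP/(_ 1%g)/eqP; rewrite !ffunE eqxx oner_eq0. Qed.
HB.instance Definition _ := GRing.Zmodule_isNzRing.Build skew
  skew_mulA skew_mul1l skew_mul1r skew_mulDl skew_mulDr skew_one_neq0.

Fact skew_scaleAl (a : k) (x y : skew) : a *: (x * y) = (a *: x) * y.
Proof.
apply/ffunP=> g; rewrite !ffunE scaler_sumr.
by apply: eq_bigr => h _; rewrite ffunE scalerAl.
Qed.
HB.instance Definition _ := GRing.Lmodule_isLalgebra.Build k skew skew_scaleAl.

Fact skew_scaleAr (a : k) (x y : skew) : a *: (x * y) = x * (a *: y).
Proof.
apply/ffunP=> g; rewrite !ffunE scaler_sumr.
by apply: eq_bigr => h _; rewrite ffunE linearZ scalerAr.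
Qed.
HB.instance Definition _ := GRing.Lalgebra_isAlgebra.Build k skew skew_scaleAr.

Lemma skew_tensorM a b g h :
  skew_tensor a g * skew_tensor b h = skew_tensor (a * act g b) (g * h)%g.
Proof.
apply/ffunP=> j; rewrite !ffunE (bigD1 g) //= !ffunE eqxx big1 ?addr0.
  rewrite (can2_eq (mulKVg g) (mulKg g)).
  by case: ifP => // _; rewrite rmorph0 mulr0.
by move=> i /negPf ig; rewrite ffunE ig mul0r.
Qed.

Definition skew_over (P : submodClosed A) : {pred skew} :=
  fun x => [forall g, x g \in P].

Lemma skew_overP (P : submodClosed A) (x : skew) :
  reflect (forall g, x g \in P) (x \in skew_over P).
Proof. exact: forallP. Qed.

Fact skew_over_submod (P : submodClosed A) : submod_closed (skew_over P).
Proof.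
split=> [|a x y /skew_overP Px /skew_overP Py]; apply/skew_overP=> g.
  by rewrite ffunE rpred0.
by rewrite !ffunE rpredD ?rpredZ.
Qed.
HB.instance Definition _ (P : submodClosed A) :=
  GRing.isSubmodClosed.Build k skew (skew_over P) (skew_over_submod P).

Lemma skew_over1 (P : submodClosed A) : 1 \in P -> 1 \in skew_over P.
Proof.
move=> P1; apply/skew_overP=> g.
by rewrite ffunE; case: ifP => // _; apply: rpred0.
Qed.

Lemma skew_overM (P Q R : submodClosed A) x y :
    (forall g a, a \in Q -> act g a \in Q) ->
    (forall a b, a \in P -> b \in Q -> a * b \in R) ->
  x \in skew_over P -> y \in skew_over Q -> x * y \in skew_over R.
Proof.
move=> actQ PQR /skew_overP Px /skew_overP Qy; apply/skew_overP=> g.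
by rewrite ffunE rpred_sum // => h _; apply: PQR => //; apply: actQ.
Qed.

End SkewGroupAlgebra.

Section TensorAndSymmetric.
Variables (k : fieldType) (V : vectType k).
Local Notation n := (\dim {:V}).
Local Notation e := (vbasis {:V}).

(* T(V), as the free algebra on a basis of V; tens_lift_gen and tens_ext give
   its universal property with respect to tens_gen : V -> T(V). *)
Definition tens_alg : Type := {malg k[{fmonom 'I_n}]}.
HB.instance Definition _ := GRing.Lalgebra.on tens_alg.

Fact tens_scalerAr (a : k) (x y : tens_alg) : a *: (x * y) = x * (a *: y).
Proof.
rewrite malgME (malgMEw (fsubset_refl _) (monalg.msuppZ_le a y)) scaler_sumr.
apply: eq_bigr => i _; rewrite scaler_sumr; apply: eq_bigr => j _.
by apply/malgP=> w; rewrite !monalg.mcoeffZ !monalg.mcoeffU mulrnAr mulrCA.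
Qed.
HB.instance Definition _ :=
  GRing.Lalgebra_isAlgebra.Build k tens_alg tens_scalerAr.

Definition tens_gen (v : V) : tens_alg := \sum_(i < n) coord e i v *: << fmu i >>.

Fact tens_gen_linear : linear tens_gen.
Proof.
move=> a u v; rewrite /tens_gen scaler_sumr -big_split /=.
by apply: eq_bigr => i _; rewrite linearP scalerDl scalerA.
Qed.
HB.instance Definition _ := GRing.isLinear.Build k V tens_alg _ tens_gen tens_gen_linear.

Definition tens_le (m : nat) : {pred tens_alg} :=
  fun x => all (fun w => fdeg w <= m)%N (monalg.msupp x).

Lemma tens_leP m (x : tens_alg) :
  reflect (forall w, w \in monalg.msupp x -> (fdeg w <= m)%N) (x \in tens_le m).
Proof. exact: allP. Qed.

Fact tens_le_submod m : submod_closed (tens_le m).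
Proof.
split=> [|a x y /tens_leP lex /tens_leP ley]; apply/tens_leP=> w.
  by rewrite monalg.msupp0.
move/(fsubsetP (monalg.msuppD_le _ _)); rewrite in_fsetU => /orP[|/ley//].
by move/(fsubsetP (monalg.msuppZ_le _ _))/lex.
Qed.
HB.instance Definition _ m :=
  GRing.isSubmodClosed.Build k tens_alg (tens_le m) (tens_le_submod m).

Lemma tens_leW m p x : (m <= p)%N -> x \in tens_le m -> x \in tens_le p.
Proof. by move=> mp /tens_leP lex; apply/tens_leP=> w /lex/leq_trans->. Qed.

Lemma tens_le1 : 1 \in tens_le 0.
Proof.
by apply/tens_leP=> w; rewrite [monalg.msupp 1]monalg.msuppU1 in_fset1 => /eqP->;
   rewrite fdeg1.
Qed.

Lemma tens_leM m p x y :
  x \in tens_le m -> y \in tens_le p -> x * y \in tens_le (m + p)%N.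
Proof.
move=> /tens_leP lex /tens_leP ley; apply/tens_leP=> w.
move/monalg.msuppM_le=> [w1 [w2 [/lex l1 /ley l2 ->]]].
by rewrite fdegM leq_add.
Qed.

Lemma tens_le_gen v : tens_gen v \in tens_le 1.
Proof.
rewrite rpred_sum // => i _; rewrite rpredZ //; apply/tens_leP=> w.
by rewrite monalg.msuppU1 in_fset1 => /eqP->; rewrite fdegU.
Qed.

Section Lift.
Variables (B : algType k) (f : V -> B).

Definition tens_lift_word (w : {fmonom 'I_n}) : B := \prod_(i <- (w : seq _)) f e`_i.

Fact tens_lift_word_morph : mmorphism tens_lift_word.
Proof.
split=> [w1 w2|]; rewrite /tens_lift_word; first by rewrite fmM big_cat.
by rewrite fm1 big_nil.
Qed.
HB.instance Definition _ :=
  monalg.isMultiplicative.Build _ B tens_lift_word tens_lift_word_morph.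

Definition tens_lift (x : tens_alg) : B :=
  monalg.mmap (in_alg B) tens_lift_word x.

Fact tens_lift_zmod : zmod_morphism tens_lift.
Proof. by move=> x y; rewrite /tens_lift raddfB. Qed.
HB.instance Definition _ :=
  GRing.isZmodMorphism.Build tens_alg B tens_lift tens_lift_zmod.

Fact tens_lift_scalable : scalable tens_lift.
Proof. by move=> a x; rewrite /tens_lift monalg.mmapZ /= mulr_algl. Qed.
HB.instance Definition _ :=
  GRing.isScalable.Build k tens_alg B _ tens_lift tens_lift_scalable.

Fact tens_lift_monoid : monoid_morphism tens_lift.
Proof.
split; first exact: monalg.mmap1.
apply: (monalg.commr_mmap_is_multiplicative _).1 => x w w'.
by rewrite /GRing.comm /= mulr_algl mulr_algr.
Qed.
HB.instance Definition _ :=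
  GRing.isMonoidMorphism.Build tens_alg B tens_lift tens_lift_monoid.

Lemma tens_liftU i : tens_lift << fmu i >> = f e`_i.
Proof.
by rewrite /tens_lift monalg.mmapU /= scale1r mul1r /tens_lift_word fmU big_seq1.
Qed.

End Lift.

Lemma tens_gen_basis (i : 'I_n) : tens_gen e`_i = << fmu i >>.
Proof.
rewrite /tens_gen (bigD1 i) //= coord_free ?(basis_free (vbasisP _)) // eqxx scale1r.
rewrite big1 ?addr0 // => j ji.
by rewrite coord_free ?(basis_free (vbasisP _)) // eq_sym (negPf ji) scale0r.
Qed.

Lemma tens_lift_gen (B : algType k) (f : {linear V -> B}) v :
  tens_lift f (tens_gen v) = f v.
Proof.
rewrite [in RHS](coord_vbasis (memvf v)) !linear_sum /=.
by apply: eq_bigr => i _; rewrite !linearZ /= tens_liftU.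
Qed.

Lemma tens_ext (B : algType k) (f g : {lrmorphism tens_alg -> B}) :
  (forall v, f (tens_gen v) = g (tens_gen v)) -> f =1 g.
Proof.
move=> fg x; rewrite [x]monalgE !linear_sum /=; apply: eq_bigr => w _.
have -> : << monalg.mcoeff w x *g w >> = monalg.mcoeff w x *: << w >> :> tens_alg.
  by apply/malgP=> u; rewrite monalg.mcoeffZ !monalg.mcoeffU mulr_natr.
rewrite !linearZ /=; congr (_ *: _).
have -> : << w >> = \prod_(i <- (w : seq _)) << fmu i >> :> tens_alg.
  case: w => w; elim: w => [|i w IHw]; first by rewrite big_nil /= -fmoneE.
  rewrite big_cons -IHw malgME !monalg.msuppU1 !big_seq_fset1.
  rewrite !monalg.mcoeffUU mulr1.
  have -> // : FMonom (i :: w) = mmul (fmu i) (FMonom w).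
  by apply/eqP; rewrite fmP fmM fmU.
rewrite (rmorph_prod f) (rmorph_prod g); apply: eq_bigr => i _.
by rewrite -tens_gen_basis; apply: fg.
Qed.

(* S(V), as the polynomials in a basis of V. *)
Definition sym_alg : Type := mpoly n k.
HB.instance Definition _ := GRing.ComAlgebra.on sym_alg.

Definition sym_gen (v : V) : sym_alg := \sum_(i < n) coord e i v *: 'X_i.

Fact sym_gen_linear : linear sym_gen.
Proof.
move=> a u v; rewrite /sym_gen scaler_sumr -big_split /=.
by apply: eq_bigr => i _; rewrite linearP scalerDl scalerA.
Qed.
HB.instance Definition _ := GRing.isLinear.Build k V sym_alg _ sym_gen sym_gen_linear.

Definition sym_homog (m : nat) : {pred sym_alg} := fun p => p \is m.-homog.

Fact sym_homog_submod m : submod_closed (sym_homog m).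
Proof. exact: dhomog_submod_closed. Qed.
HB.instance Definition _ m :=
  GRing.isSubmodClosed.Build k sym_alg (sym_homog m) (sym_homog_submod m).

Lemma sym_homog_gen v : sym_gen v \in sym_homog 1.
Proof.
rewrite rpred_sum // => i _; rewrite rpredZ //.
by rewrite unfold_in /sym_homog dhomogX /= mdeg1.
Qed.

Section GroupAction.
Variables (gT : finGroupType) (rho : lin_action gT V).

Definition tens_act_fun (g : gT) : tens_alg -> tens_alg :=
  tens_lift (tens_gen \o rho g).
HB.instance Definition _ g := GRing.LRMorphism.on (tens_act_fun g).

Lemma tens_act_gen g v : tens_act_fun g (tens_gen v) = tens_gen (rho g v).
Proof. exact: tens_lift_gen. Qed.

Fact tens_act1 x : tens_act_fun 1%g x = x.
Proof.
have := @tens_ext tens_alg (tens_act_fun 1%g) idfun; apply=> v.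
by rewrite /= tens_act_gen lin_act1.
Qed.
Fact tens_actM g h x :
  tens_act_fun (g * h)%g x = tens_act_fun g (tens_act_fun h x).
Proof.
have := @tens_ext tens_alg (tens_act_fun (g * h)%g)
  (tens_act_fun g \o tens_act_fun h); apply=> v.
by rewrite /= !tens_act_gen lin_actM.
Qed.
Definition tens_act : alg_action gT tens_alg :=
  @AlgAction k gT tens_alg tens_act_fun tens_act1 tens_actM.

Definition sym_act_fun (g : gT) (p : sym_alg) : sym_alg :=
  p \mPo [tuple sym_gen (rho g e`_i) | i < n].
Fact sym_act_zmod g : zmod_morphism (sym_act_fun g).
Proof. exact: comp_mpoly_is_additive. Qed.
HB.instance Definition _ g :=
  GRing.isZmodMorphism.Build sym_alg sym_alg (sym_act_fun g) (sym_act_zmod g).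

Fact sym_act_scalable g : scalable (sym_act_fun g).
Proof. exact: comp_mpoly_is_linear. Qed.
HB.instance Definition _ g :=
  GRing.isScalable.Build k sym_alg sym_alg _ (sym_act_fun g) (sym_act_scalable g).

Fact sym_act_monoid g : monoid_morphism (sym_act_fun g).
Proof. by split; [apply: rmorph1 | apply: (rmorphM (comp_mpoly _))]. Qed.
HB.instance Definition _ g :=
  GRing.isMonoidMorphism.Build sym_alg sym_alg (sym_act_fun g) (sym_act_monoid g).

Lemma sym_act_gen g v : sym_act_fun g (sym_gen v) = sym_gen (rho g v).
Proof.
rewrite [in RHS](coord_vbasis (memvf v)) !linear_sum /=.
apply: eq_bigr => i _; rewrite !linearZ /=; congr (_ *: _).
rewrite /sym_act_fun comp_mpolyXU (nth_map i) ?size_enum_ord //.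
by rewrite nth_ord_enum.
Qed.

Lemma sym_gen_basis (i : 'I_n) : sym_gen e`_i = 'X_i.
Proof.
rewrite /sym_gen (bigD1 i) //= coord_free ?(basis_free (vbasisP _)) // eqxx scale1r.
rewrite big1 ?addr0 // => j ji.
by rewrite coord_free ?(basis_free (vbasisP _)) // eq_sym (negPf ji) scale0r.
Qed.

Lemma sym_ext (B : algType k) (f g : {lrmorphism sym_alg -> B}) :
  (forall v, f (sym_gen v) = g (sym_gen v)) -> f =1 g.
Proof.
move=> fg x; rewrite [x]mpolyE !linear_sum /=; apply: eq_bigr => w _.
rewrite !linearZ /=; congr (_ *: _).
rewrite mpolyXE_id (rmorph_prod f) (rmorph_prod g); apply: eq_bigr => i _.
rewrite (rmorphXn f) (rmorphXn g) -sym_gen_basis; congr (_ ^+ _); exact: fg.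
Qed.

Fact sym_act1 x : sym_act_fun 1%g x = x.
Proof.
have := @sym_ext sym_alg (sym_act_fun 1%g) idfun; apply=> v.
by rewrite /= sym_act_gen lin_act1.
Qed.
Fact sym_actM g h x :
  sym_act_fun (g * h)%g x = sym_act_fun g (sym_act_fun h x).
Proof.
have := @sym_ext sym_alg (sym_act_fun (g * h)%g)
  (sym_act_fun g \o sym_act_fun h); apply=> v.
by rewrite /= !sym_act_gen lin_actM.
Qed.
Definition sym_act : alg_action gT sym_alg :=
  @AlgAction k gT sym_alg sym_act_fun sym_act1 sym_actM.

Lemma tens_act_le g m x : x \in tens_le m -> tens_act g x \in tens_le m.
Proof.
move=> /tens_leP lex; rewrite [x]monalgE linear_sum big_seq rpred_sum //= => w xw.
rewrite /tens_act_fun /tens_lift monalg.mmapU /= mulr_algl rpredZ //.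
apply: tens_leW (lex _ xw) _; rewrite /tens_lift_word /fdeg.
elim: (w : seq _) => [|i u IHu]; first by rewrite big_nil tens_le1.
by rewrite big_cons; apply: (@tens_leM 1 (size u)) => //; apply: tens_le_gen.
Qed.

Lemma sym_act_homog g m p : p \in sym_homog m -> sym_act g p \in sym_homog m.
Proof.
move=> /dhomogP homp.
rewrite [p]mpolyE linear_sum big_seq rpred_sum //= => w pw.
rewrite linearZ rpredZ //= -(homp _ pw) /sym_act_fun comp_mpolyX /= mdegE.
elim/big_rec2: _ => [|i d q _ homq]; first exact: dhomog1.
apply: dhomogM => //; rewrite -[X in X.-homog]mul1n; apply: dhomogMn.
by rewrite tnth_mktuple; apply: sym_homog_gen.
Qed.

End GroupAction.
End TensorAndSymmetric.

Section GradedAlgebras.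
Variable k : comNzRingType.

(* Only the data that an isomorphism has to respect. *)
Record graded_algebra := GradedAlgebra {
  gra_comp :> nat -> lmodType k;
  gra_one : gra_comp 0;
  gra_mul : forall i j, gra_comp i -> gra_comp j -> gra_comp (i + j)%N }.

Definition graded_iso (A B : graded_algebra) : Prop :=
  exists f : forall i, {linear A i -> B i},
    [/\ forall i, bijective (f i),
        f 0%N (gra_one A) = gra_one B
      & forall i j (x : A i) (y : A j),
          f (i + j)%N (gra_mul x y) = gra_mul (f i x) (f j y)].

Section Internal.
Variables (A : algType k) (G : nat -> submodClosed A).
Hypothesis G1 : 1 \in G 0.
Hypothesis GM : forall i j x y, x \in G i -> y \in G j -> x * y \in G (i + j)%N.

Definition internal_mul i j (x : submodule (G i)) (y : submodule (G j)) :
    submodule (G (i + j)%N) :=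
  Submodule (GM (valP x) (valP y)).

Definition internal_graded : graded_algebra :=
  @GradedAlgebra (fun i => submodule (G i)) (Submodule G1) internal_mul.
End Internal.

(* The multiplication is kept apart from the carrier because a filtered
   algebra may be zero, which algType excludes. *)
Record filtered_algebra := FilteredAlgebra {
  fil_car :> lmodType k;
  fil_one : fil_car;
  fil_mul : fil_car -> fil_car -> fil_car;
  fil_deg : nat -> submodClosed fil_car;
  fil_mulBl : forall x x' y, fil_mul (x - x') y = fil_mul x y - fil_mul x' y;
  fil_mulBr : forall x y y', fil_mul x (y - y') = fil_mul x y - fil_mul x y';
  fil_degS : forall m x, x \in fil_deg m -> x \in fil_deg m.+1;
  fil_deg1 : fil_one \in fil_deg 0;
  fil_degM : forall i j x y, x \in fil_deg i -> y \in fil_deg j ->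
    fil_mul x y \in fil_deg (i + j)%N }.

Section AssociatedGraded.
Variable A : filtered_algebra.
Local Notation F := (fil_deg A).

(* F (m - 1) as a subspace of F m, with F (-1) = 0. *)
Definition fil_below (m : nat) : {pred submodule (F m)} := fun x =>
  if m is m'.+1 then val x \in F m' else val x == 0.

Lemma fil_below0E (x : submodule (F 0)) : (x \in @fil_below 0) = (val x == 0).
Proof. by []. Qed.
Lemma fil_belowSE m (x : submodule (F m.+1)) :
  (x \in @fil_below m.+1) = (val x \in F m).
Proof. by []. Qed.

Fact fil_below_submod m : submod_closed (@fil_below m).
Proof.
case: m => [|m]; split=> [|a x y].
- by rewrite fil_below0E.
- rewrite !fil_below0E => /eqP x0 /eqP y0.
  by rewrite linearP /= x0 y0 scaler0 addr0.
- by rewrite fil_belowSE raddf0 rpred0.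
- by rewrite !fil_belowSE linearP /= => Fx Fy; rewrite rpredD ?rpredZ.
Qed.
HB.instance Definition _ m := GRing.isSubmodClosed.Build k (submodule (F m))
  (@fil_below m) (fil_below_submod m).

Definition gr_comp (m : nat) : lmodType k := lquot (@fil_below m).

Definition gr_class m (x : submodule (F m)) : gr_comp m := \pi_(lquot (@fil_below m)) x.
Definition gr_repr m (x : gr_comp m) : submodule (F m) := repr (x : lquot _).

Definition fil_sub_mul i j (x : submodule (F i)) (y : submodule (F j)) :
    submodule (F (i + j)%N) :=
  Submodule (fil_degM (valP x) (valP y)).

Definition gr_mul i j (x : gr_comp i) (y : gr_comp j) : gr_comp (i + j)%N :=
  gr_class (fil_sub_mul (gr_repr x) (gr_repr y)).

Lemma gr_class_eqP m (x y : submodule (F m)) :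
  reflect (gr_class x = gr_class y) (x - y \in @fil_below m).
Proof. exact: (lquot_eqP (@fil_below m) x y). Qed.

Lemma gr_reprK m (x : gr_comp m) : gr_class (gr_repr x) = x.
Proof. exact: (@reprK _ (lquot (@fil_below m)) x). Qed.

Lemma fil_mul0 x : fil_mul 0 x = 0 :> A.
Proof. by have := fil_mulBl 0 0 x; rewrite !subrr. Qed.

Lemma fil_mulr0 x : fil_mul x 0 = 0 :> A.
Proof. by have := fil_mulBr x 0 0; rewrite !subrr. Qed.

Lemma fil_below_mull i j (x : submodule (F i)) (y : submodule (F j)) :
  x \in @fil_below i -> fil_sub_mul x y \in @fil_below (i + j)%N.
Proof.
case: i x => [|i] x.
  rewrite fil_below0E => /eqP x0; have -> : fil_sub_mul x y = 0.
    by apply: val_inj; rewrite /= x0 fil_mul0.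
  exact: rpred0.
by rewrite fil_belowSE => Fx; apply: fil_degM => //; apply: valP.
Qed.

Lemma fil_below_mulr i j (x : submodule (F i)) (y : submodule (F j)) :
  y \in @fil_below j -> fil_sub_mul x y \in @fil_below (i + j)%N.
Proof.
case: j y => [|j] y.
  rewrite fil_below0E => /eqP y0; have -> : fil_sub_mul x y = 0.
    by apply: val_inj; rewrite /= y0 fil_mulr0.
  exact: rpred0.
rewrite fil_belowSE => Fy.
suff : forall m, m = (i + j).+1 -> forall z : submodule (F m),
    val z = fil_mul (val x) (val y) -> z \in @fil_below m.
  by apply; rewrite ?addnS.
move=> _ -> z zE; rewrite fil_belowSE zE.
by apply: fil_degM => //; apply: valP.
Qed.

Lemma gr_mul_class i j (x : submodule (F i)) (y : submodule (F j)) :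
  gr_mul (gr_class x) (gr_class y) = gr_class (fil_sub_mul x y).
Proof.
rewrite /gr_mul; set x' := gr_repr _; set y' := gr_repr _.
have xx' : x' - x \in @fil_below i by apply/gr_class_eqP; rewrite gr_reprK.
have yy' : y' - y \in @fil_below j by apply/gr_class_eqP; rewrite gr_reprK.
apply/gr_class_eqP.
have -> : fil_sub_mul x' y' - fil_sub_mul x y
        = fil_sub_mul (x' - x) y' + fil_sub_mul x (y' - y).
  by apply: val_inj; rewrite /= fil_mulBl fil_mulBr addrA subrK.
by apply: rpredD; [apply: fil_below_mull | apply: fil_below_mulr].
Qed.

Definition assoc_graded : graded_algebra :=
  @GradedAlgebra gr_comp (gr_class (Submodule (fil_deg1 A))) gr_mul.

End AssociatedGraded.
End GradedAlgebras.

Section DrinfeldOrbifoldAlgebra.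
Variables (k : fieldType) (gT : finGroupType) (V : vectType k).
Variable rho : lin_action gT V.

Local Notation TG := (skew_alg (tens_act rho)).
Local Notation SG := (skew_alg (sym_act rho)).

(* The value kappa v w in (k + V) (x) kG has component kappa v w g at g. *)
Variable kappa : {bilinear V -> V -> {ffun gT -> k^o * V}}.

Definition kappaC (g : gT) (v w : V) : k := (kappa v w g).1.
Definition kappaL (g : gT) (v w : V) : V := (kappa v w g).2.

Definition kappa_act (h : gT) (v w : V) : {ffun gT -> k^o * V} :=
  let v' := rho h^-1%g v in let w' := rho h^-1%g w in
  \sum_g [ffun x => if x == (h * g * h^-1)%g
                    then (kappaC g v' w', rho h (kappaL g v' w')) else 0].

Definition kappa_invariant : Prop :=
  forall h v w, kappa_act h v w = kappa v w.

Definition kappa_tens (v w : V) : TG :=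
  \sum_g skew_tensor (tens_act rho)
           ((kappaC g v w)%:A + tens_gen (kappaL g v w)) g.

Definition tens_in (v : V) : TG := skew_tensor (tens_act rho) (tens_gen v) 1%g.

Definition H_rel (r : TG) : Prop :=
  exists v w, r = tens_in v * tens_in w - tens_in w * tens_in v - kappa_tens v w.

Definition H_alg : Type := quot_alg H_rel.
HB.instance Definition _ := GRing.Lmodule.on H_alg.
HB.instance Definition _ := GRing.PzRing.on H_alg.

Local Notation TG_le m := (@skew_over k gT _ (tens_act rho) (@tens_le k V m)).
Local Notation H_pi := (quot_alg_pi H_rel).

(* Degree 1 for vectors and 0 for group elements: the image of the elements of
   T(V) # G all of whose words have length at most m. *)
Definition H_le (m : nat) : {pred H_alg} := fun y =>
  `[< exists2 x : TG, x \in TG_le m & y = H_pi x >].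

Lemma H_leP m (y : H_alg) :
  reflect (exists2 x : TG, x \in TG_le m & y = H_pi x) (y \in H_le m).
Proof. exact: asboolP. Qed.

Fact H_le_submod m : submod_closed (H_le m).
Proof.
split=> [|a _ _ /H_leP[x Fx ->] /H_leP[y Fy ->]]; apply/H_leP.
  by exists 0; rewrite ?rpred0 ?linear0.
exists (a *: x + y); first by rewrite rpredD ?rpredZ.
by rewrite linearP.
Qed.
HB.instance Definition _ m :=
  GRing.isSubmodClosed.Build k H_alg (H_le m) (H_le_submod m).

Fact H_leS m (x : H_alg) : x \in H_le m -> x \in H_le m.+1.
Proof.
move=> /H_leP[y /skew_overP Fy ->]; apply/H_leP; exists y => //.
by apply/skew_overP=> g; apply: tens_leW (Fy g).
Qed.

Fact H_le1 : 1 \in H_le 0.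
Proof.
by apply/H_leP; exists 1; [apply/skew_over1/tens_le1 | rewrite rmorph1].
Qed.

Fact H_leM i j (x y : H_alg) :
  x \in H_le i -> y \in H_le j -> x * y \in H_le (i + j)%N.
Proof.
move=> /H_leP[x' Fx ->] /H_leP[y' Fy ->]; apply/H_leP.
exists (x' * y'); last by rewrite rmorphM.
apply: skew_overM Fx Fy => [g a|a b]; [exact: tens_act_le | exact: tens_leM].
Qed.

Definition H_filtered : filtered_algebra k :=
  @FilteredAlgebra k H_alg 1 *%R (fun m => H_le m)
    (fun x x' y => mulrBl y x x') (@mulrBr H_alg) H_leS H_le1 H_leM.

Definition SG_homog (m : nat) : submodClosed SG :=
  @skew_over k gT _ (sym_act rho) (@sym_homog k V m).

Fact SG_homog1 : 1 \in SG_homog 0.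
Proof. by apply/skew_over1/dhomog1. Qed.

Fact SG_homogM i j (x y : SG) :
  x \in SG_homog i -> y \in SG_homog j -> x * y \in SG_homog (i + j)%N.
Proof. by apply: skew_overM => [g a|a b]; [exact: sym_act_homog | exact: dhomogM]. Qed.

Definition SG_graded : graded_algebra k := internal_graded SG_homog1 SG_homogM.

Definition drinfeld_orbifold_algebra : Prop :=
  graded_iso (assoc_graded H_filtered) SG_graded.

End DrinfeldOrbifoldAlgebra.

(* Main.v *)
Require Import Defs.
Set Warnings "-notation-overridden,-ambiguous-paths,-notation-incompatible-prefix".
Set Warnings "-redundant-canonical-projection,-projection-no-head-constant".
From HB Require Import structures.
From mathcomp Require Import all_boot all_algebra all_fingroup all_solvable.
From mathcomp Require Import boolp.
From mathcomp Require Import finmap ssrcomplements monalg mpoly.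
From mathcomp Require Import zify.

Set Implicit Arguments.
Unset Strict Implicit.
Unset Printing Implicit Defensive.

Import GRing.Theory.
Local Open Scope ring_scope.

(** Write [r(v,w) = vw - wv - kappa(v,w)] for the defining relations and fix a
    basis of V. Sending a monomial of S # G to its sorted word gives a linear
    map [sort_elt] from S # G to T(V) # G. Modulo the relations every word is
    its sorted rearrangement plus terms of smaller degree ([reorder_word],
    [reorder_top]), so sorting induces a surjective graded algebra map from
    S # G to the associated graded algebra of H ([natural_map_surj],
    [natural_mapM]). It is an isomorphism exactly when sorted words are linearly
    independent in H, the property [pbw]. Conversely an abstract graded
    isomorphism already forces [pbw]: the homogeneous components of S # G are
    finite-dimensional, so a surjection between components of equal dimension is
    injective ([drinfeld_pbw]).

    It remains to compare [pbw] with the four conditions. The link is a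
    computation in T(V) # G. Since [2ab = (ab + ba) + (ab - ba)], twice the
    commutator of x with [u g], u in V, is
    [((x - gx) u + u (x - gx)) g + [x + gx, u] g], and the last bracket is
    [kappa(x + gx, u)] up to a relation. Summing over the cyclic permutations of
    x, y, z gives [twice_jacobiator]: up to relations, twice
    [[x,kappa(y,z)] + [y,kappa(z,x)] + [z,kappa(x,y)]] is the symmetrisation of
    the quadratic element of condition (ii) plus an element of degree at most 1
    whose coefficients are the differences of the two sides of (iii) and (iv).

    If [pbw] holds, this cyclic sum vanishes in H by the Jacobi identity, so its
    quadratic part and then its part of degree at most 1 vanish, which gives
    (ii), (iii) and (iv) ([pbw_conditions]); conjugating a relation by a group
    element gives (i) ([pbw_invariant]).

    If the conditions hold, linear maps from T(V) # G to S # G are constructed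
    that invert sorting and kill all products [a r(v,w) b] up to a given degree
    ([normal_form]); an element of the ideal is killed by one of them, and [pbw]
    follows. The construction goes by induction on the degree. In a new degree
    the value on a word is found by sorting it, each adjacent transposition
    contributing a correction of smaller degree that is already known. The
    result is independent of the order of the transpositions because the
    corrections respect the two ways of reversing three letters, which is the
    vanishing of the cyclic sum above, and because disjoint transpositions
    commute, which uses the relations of smaller degree
    ([sort_value_descent], [correction_braid], [correction_far]). Invariance lets
    a group element be moved across a relation. *)

(** * Sorting words by adjacent transpositions *)

Section Sorting.
Variables (n : nat) (M : zmodType).
Local Notation word := (seq 'I_n).
Implicit Types (a b d w : word) (x y z : 'I_n).

Definition weakly_increasing w := sorted leq [seq val i | i <- w].

Fixpoint inversions w : nat :=
  if w is x :: w' then (count (fun y : 'I_n => (y < x)%N) w' + inversions w')%N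
  else 0%N.

Lemma inversions_swap a x y b : (y < x)%N ->
  inversions (a ++ x :: y :: b) = (inversions (a ++ y :: x :: b)).+1.
Proof.
move=> yx; elim: a => [|z a IHa] /=.
  by rewrite yx (ltnNge x) (ltnW yx) /=; lia.
by rewrite IHa !count_cat /=; lia.
Qed.

(** Returns the word cut around the descent, so that the two letters can be
    exchanged without position arithmetic. *)
Fixpoint first_descent w : option (word * 'I_n * 'I_n * word) :=
  if w is x :: w' then
    if w' is y :: w'' then
      if (y < x)%N then Some ([::], x, y, w'')
      else if first_descent w' is Some (a, x', y', b)
           then Some (x :: a, x', y', b) else None
    else None
  else None.

Lemma first_descent_some w a x y b :
  first_descent w = Some (a, x, y, b) -> w = a ++ x :: y :: b /\ (y < x)%N.
Proof.
elim: w a => // z [|t w] IHw a //=.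
case: ifP => [tz [<- <- <- <-] //|_].
rewrite -/(first_descent (t :: w)).
case E: (first_descent (t :: w)) => [[[[a' x'] y'] b']|] //.
by case=> <- xE yE bE; move: E; rewrite xE yE bE => /IHw[-> ->].
Qed.

Lemma first_descent_none w : first_descent w = None -> weakly_increasing w.
Proof.
rewrite /weakly_increasing; elim: w => // z [|t w] IHw //=.
case: ifP => // tz.
rewrite -/(first_descent (t :: w)).
case E: (first_descent (t :: w)) => [[[[a' x'] y'] b']|] // _.
by rewrite leqNgt tz /=; apply: IHw.
Qed.

Lemma weakly_increasing_descent a x y b :
  weakly_increasing (a ++ x :: y :: b) -> (y < x)%N = false.
Proof.
rewrite /weakly_increasing map_cat => /cat_sorted2[_] /= /andP[xy _].
by rewrite ltnNge xy.
Qed.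

(** Two adjacent pairs of a word coincide, overlap in one letter, or are
    disjoint: the critical pairs of sorting by transpositions. *)
Lemma adjacent_pairs_cases a x y b a' x' y' b' :
    a ++ x :: y :: b = a' ++ x' :: y' :: b' -> (size a <= size a')%N ->
  [\/ [/\ a' = a, x' = x, y' = y & b' = b],
      [/\ a' = rcons a x, x' = y & b = y' :: b']
    | exists2 d, a' = a ++ x :: y :: d & b = d ++ x' :: y' :: b'].
Proof.
elim: a a' => [|z a IHa] [|z' a'] //=.
- by case=> -> -> -> _; constructor 1.
- case: a' => [|z'' a'] /=; first by case=> -> <- -> _; constructor 2.
  by case=> -> -> -> _; constructor 3; exists a'.
- case=> -> /IHa{}IHa /IHa[[-> -> -> ->]|[-> -> ->]|[d -> ->]].
  + by constructor 1.
  + by constructor 2.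
  + by constructor 3; exists d.
Qed.

Variables (base : word -> M) (c : word -> 'I_n -> 'I_n -> word -> M) (m : nat).

(** The value of a word is its value once sorted plus the corrections [c] met
    while exchanging the first descent again and again. The fuel is the number
    of inversions, which every exchange lowers by one. *)
Fixpoint bubble_sort_value (fuel : nat) w : M :=
  if fuel is fuel'.+1 then
    if first_descent w is Some (a, x, y, b)
    then bubble_sort_value fuel' (a ++ y :: x :: b) + c a x y b
    else base w
  else base w.

Definition sort_value w := bubble_sort_value (inversions w) w.

Lemma sort_value_sorted w : weakly_increasing w -> sort_value w = base w.
Proof.
move=> sw; rewrite /sort_value; case: (inversions w) => //= f.
case E: (first_descent w) => [[[[a x] y] b]|] //.
have [wE yx] := first_descent_some E.
by rewrite wE in sw; rewrite (weakly_increasing_descent sw) in yx.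
Qed.

Lemma sort_value_first_descent w a x y b :
    first_descent w = Some (a, x, y, b) ->
  sort_value w = sort_value (a ++ y :: x :: b) + c a x y b.
Proof.
move=> E; have [wE yx] := first_descent_some E.
rewrite /sort_value {1}wE inversions_swap // /= E; congr (_ + _).
Qed.

Hypothesis c_far : forall a x y d x' y' b,
  size (a ++ x :: y :: d ++ x' :: y' :: b) = m ->
  c a x y (d ++ x' :: y' :: b) + c (a ++ y :: x :: d) x' y' b
  = c (a ++ x :: y :: d) x' y' b + c a x y (d ++ y' :: x' :: b).
Hypothesis c_braid : forall a x y z b,
  size (a ++ x :: y :: z :: b) = m ->
  c a x y (z :: b) + c (rcons a y) x z b + c a y z (x :: b)
  = c (rcons a x) y z b + c a x z (y :: b) + c (rcons a z) x y b.
Hypothesis c_anti : forall a x y b, c a y x b = - c a x y b.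
Hypothesis c_diag : forall a x b, c a x x b = 0.

(** Confluence: any descent may be exchanged first. By induction on the number
    of inversions it suffices to compare two descents of the same word. If they
    are disjoint, exchanging both in either order meets the same word and
    [c_far] equates the corrections; if they overlap, both orders reach the
    reversal of three letters and [c_braid] applies. *)
Lemma sort_value_descent w a x y b :
    size w = m -> w = a ++ x :: y :: b -> (y < x)%N ->
  sort_value w = sort_value (a ++ y :: x :: b) + c a x y b.
Proof.
have [k] := ubnP (inversions w).
elim: k w a x y b => // k IHk w a x y b inv_w size_w wE yx.
case E: (first_descent w) => [[[[a' x'] y'] b']|]; last first.
  by have := first_descent_none E; rewrite wE => /weakly_increasing_descent;
    rewrite yx.
have [wE' yx'] := first_descent_some E.
rewrite (sort_value_first_descent E).
have {IHk}IH u a1 x1 y1 b1 : u = a1 ++ x1 :: y1 :: b1 -> (y1 < x1)%N ->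
    size u = m -> (inversions u < k)%N ->
    sort_value u = sort_value (a1 ++ y1 :: x1 :: b1) + c a1 x1 y1 b1.
  by move=> *; apply: IHk.
have confluent a1 x1 y1 b1 a2 x2 y2 b2 : w = a1 ++ x1 :: y1 :: b1 ->
    w = a2 ++ x2 :: y2 :: b2 -> (y1 < x1)%N -> (y2 < x2)%N ->
    (size a1 <= size a2)%N ->
    sort_value (a1 ++ y1 :: x1 :: b1) + c a1 x1 y1 b1
    = sort_value (a2 ++ y2 :: x2 :: b2) + c a2 x2 y2 b2.
  move=> w1 w2 yx1 yx2 le12; have := w1; rewrite w2 => /esym w12.
  rewrite {}w1 in inv_w size_w; rewrite inversions_swap // in inv_w.
  have [[-> -> -> ->]//|[a2E x2E b1E]|[d a2E b1E]] :=
    adjacent_pairs_cases w12 le12; clear w12.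
  (* x1 > y1 = x2 > y2: continue both ways down to y2, y1, x1 *)
  - subst a2 x2 b1; rewrite !cat_rcons.
    have sz := size_w; rewrite !size_cat /= in sz.
    have i1 := inversions_swap (rcons a1 y1) b2 (ltn_trans yx2 yx1).
    have i2 := inversions_swap a1 (x1 :: b2) yx2.
    have i3 := inversions_swap (rcons a1 y2) b2 yx1.
    have i4 := inversions_swap a1 (y1 :: b2) (ltn_trans yx2 yx1).
    rewrite !cat_rcons in i1 i3.
    rewrite (IH (a1 ++ y1 :: x1 :: y2 :: b2) (rcons a1 y1) x1 y2 b2) ?cat_rcons
      ?size_cat //=; try lia.
    rewrite (IH (a1 ++ y1 :: y2 :: x1 :: b2) a1 y1 y2 (x1 :: b2))
      ?size_cat //=; try lia.
    rewrite (IH (a1 ++ x1 :: y2 :: y1 :: b2) a1 x1 y2 (y1 :: b2))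
      ?size_cat //=; try lia.
    rewrite (IH (a1 ++ y2 :: x1 :: y1 :: b2) (rcons a1 y2) x1 y1 b2) ?cat_rcons
      ?size_cat //=; try lia.
    rewrite -!addrA; congr (_ + _).
    rewrite [LHS]addrC [X in X + _ = _]addrC [RHS]addrC [X in _ = X + _]addrC.
    exact: c_braid.
  (* disjoint pairs: exchange the other one as well *)
  - subst a2 b1; have sz := size_w; rewrite !size_cat /= !size_cat /= in sz.
    have i1 := inversions_swap (a1 ++ y1 :: x1 :: d) b2 yx2.
    have i2 := inversions_swap (a1 ++ x1 :: y1 :: d) b2 yx2.
    have i3 := inversions_swap a1 (d ++ y2 :: x2 :: b2) yx1.
    rewrite -!catA /= in i1 i2 i3 *.
    rewrite (IH (a1 ++ y1 :: x1 :: d ++ x2 :: y2 :: b2) (a1 ++ y1 :: x1 :: d)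
      x2 y2 b2) -?catA //= ?size_cat /= ?size_cat /=; try lia.
    rewrite (IH (a1 ++ x1 :: y1 :: d ++ y2 :: x2 :: b2) a1 x1 y1
      (d ++ y2 :: x2 :: b2)) //= ?size_cat /= ?size_cat /=; try lia.
    by rewrite -!addrA; congr (_ + _); rewrite addrC c_far // addrC.
by have [le|/ltnW le] := leqP (size a) (size a'); [symmetry|]; apply: confluent.
Qed.

Lemma sort_value_swap a x y b : size (a ++ x :: y :: b) = m ->
  sort_value (a ++ x :: y :: b) = sort_value (a ++ y :: x :: b) + c a x y b.
Proof.
move=> sz; have [xy|yx|/val_inj->] := ltngtP x y; last by rewrite c_diag addr0.
- have sz' : size (a ++ y :: x :: b) = m by rewrite -sz !size_cat.
  by rewrite (sort_value_descent sz' erefl xy) c_anti subrK.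
- exact: sort_value_descent.
Qed.

End Sorting.

(** * Words in the tensor algebra and monomials in the symmetric algebra *)

Section Words.
Variables (k : fieldType) (V : vectType k).
Local Notation n := (\dim {:V}).
Local Notation e := (vbasis {:V}).
Local Notation word := (seq 'I_n).
Local Notation T := (tens_alg V).
Local Notation S := (sym_alg V).

Lemma basis_ind (P : V -> Prop) :
    P 0 -> (forall a u v, P u -> P v -> P (a *: u + v)) ->
    (forall i : 'I_n, P e`_i) ->
  forall v, P v.
Proof.
move=> P0 PD Pe v; rewrite (coord_vbasis (memvf v)).
elim/big_rec: _ => // i u _ Pu; exact: PD.
Qed.

Definition tens_word (w : word) : T := \prod_(i <- w) tens_gen e`_i.

Lemma tens_wordE (w : word) : tens_word w = << FMonom w >>.
Proof.
rewrite /tens_word; elim: w => [|i w IHw]; first by rewrite big_nil -fmoneE.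
rewrite big_cons IHw tens_gen_basis malgME !monalg.msuppU1 !big_seq_fset1.
rewrite !monalg.mcoeffUU mulr1.
have -> // : FMonom (i :: w) = mmul (fmu i) (FMonom w).
by apply/eqP; rewrite fmP fmM fmU.
Qed.

Lemma tens_wordP (x : T) :
  x = \sum_(w <- monalg.msupp x) monalg.mcoeff w x *: tens_word w.
Proof.
rewrite [LHS]monalgE; apply: eq_bigr => w _; rewrite tens_wordE.
apply/malgP=> u; rewrite monalg.mcoeffZ !monalg.mcoeffU -?fmP.
have -> : FMonom w = w by apply/eqP; rewrite fmP.
by rewrite mulr_natr.
Qed.

Lemma tens_word_le w : tens_word w \in @tens_le k V (size w).
Proof.
by apply/tens_leP=> u; rewrite tens_wordE monalg.msuppU1 in_fset1 => /eqP->.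
Qed.

Lemma tens_le_ind m (P : T -> Prop) :
    P 0 -> (forall a x y, P x -> P y -> P (a *: x + y)) ->
    (forall w, (size w <= m)%N -> P (tens_word w)) ->
  forall x, x \in @tens_le k V m -> P x.
Proof.
move=> P0 PD Pw x /tens_leP lex; rewrite [x]tens_wordP big_seq.
elim/big_rec: _ => // w y wx Py; apply: PD => //; exact/Pw/lex.
Qed.

(** The universal property of the basis of words, for linear maps. *)
Section Extension.
Variables (M : lmodType k) (f : word -> M).

Definition word_extend (x : T) : M :=
  \sum_(w <- monalg.msupp x) monalg.mcoeff w x *: f w.

Lemma word_extendEw (d : {fset {fmonom 'I_n}}) x :
  fsubset (monalg.msupp x) d ->
  word_extend x = \sum_(w <- d) monalg.mcoeff w x *: f w.
Proof.
move=> xd; apply: big_fset_incl => // w _ /mcoeff_outdom->.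
by rewrite scale0r.
Qed.

Fact word_extend_linear : linear word_extend.
Proof.
move=> a x y; pose d := fsetU (monalg.msupp x) (monalg.msupp y).
have dx : fsubset (monalg.msupp x) d by apply: fsubsetUl.
have dy : fsubset (monalg.msupp y) d by apply: fsubsetUr.
have dxy : fsubset (monalg.msupp (a *: x + y)) d.
  apply: fsubset_trans (monalg.msuppD_le _ _) _.
  by apply: fsetSU; apply: monalg.msuppZ_le.
rewrite (word_extendEw dx) (word_extendEw dy) (word_extendEw dxy).
rewrite scaler_sumr -big_split; apply: eq_bigr => w _ /=.
by rewrite monalg.mcoeffD monalg.mcoeffZ scalerDl scalerA.
Qed.
HB.instance Definition _ :=
  GRing.isLinear.Build k T M _ word_extend word_extend_linear.

Lemma word_extend_word w : word_extend (tens_word w) = f w.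
Proof.
rewrite /word_extend tens_wordE monalg.msuppU1 big_seq_fset1.
by rewrite monalg.mcoeffUU scale1r.
Qed.

End Extension.

(** The splitting of the abelianisation that lists the variables of a monomial
    in increasing order. *)
Definition sort_monomial (x : S) : T :=
  \sum_(m <- msupp x) x@_m *: tens_word (m2s m).

Lemma sort_monomialEw d (x : S) : (msize x <= d)%N ->
  sort_monomial x = \sum_(m : 'X_{1..n < d}) x@_m *: tens_word (m2s m).
Proof.
move=> lex; rewrite /sort_monomial (big_mksub 'X_{1..n < d}) ?msupp_uniq //=; last first.
  by move=> m /msize_mdeg_lt /leq_trans; apply.
rewrite big_rmcond //= => m.
by move/memN_msupp_eq0->; rewrite scale0r.
Qed.

Fact sort_monomial_linear : linear sort_monomial.
Proof.
move=> a x y; pose d := maxn (msize x) (msize y).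
have dx : (msize x <= d)%N by apply: leq_maxl.
have dy : (msize y <= d)%N by apply: leq_maxr.
have dxy : (msize (a *: x + y) <= d)%N.
  apply: leq_trans (msizeD_le _ _) _.
  by rewrite geq_max dy (leq_trans (msizeZ_le _ _) dx).
rewrite (sort_monomialEw dx) (sort_monomialEw dy) (sort_monomialEw dxy).
rewrite scaler_sumr -big_split; apply: eq_bigr => m _ /=.
by rewrite mcoeffD mcoeffZ scalerDl scalerA.
Qed.
HB.instance Definition _ :=
  GRing.isLinear.Build k S T _ sort_monomial sort_monomial_linear.

Lemma sort_monomialX m : sort_monomial 'X_[m] = tens_word (m2s m).
Proof. by rewrite /sort_monomial msuppX big_seq1 mcoeffX eqxx scale1r. Qed.

Lemma weakly_increasing_m2s (m : 'X_{1..n}) : weakly_increasing (m2s m).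
Proof. exact: srt_m2s. Qed.

Lemma m2s_s2m (w : word) : weakly_increasing w -> m2s (s2m w) = w.
Proof.
move=> sw; apply/(inj_map val_inj).
apply: (sorted_eq leq_trans anti_leq (srt_m2s _) sw).
apply/perm_map/allP=> /= i _; have /mnmP/(_ i) := s2mK (s2m w).
by rewrite !mnmE => ->.
Qed.

Definition abel : T -> S := tens_lift (@sym_gen k V).
HB.instance Definition _ := GRing.LRMorphism.on abel.

Lemma abel_gen v : abel (tens_gen v) = sym_gen v.
Proof. exact: tens_lift_gen. Qed.

Lemma s2m_nil : s2m ([::] : word) = 0%MM.
Proof. by apply/mnmP=> j; rewrite [RHS]mnm0E mnmE. Qed.

Lemma s2m_cons i (w : word) : s2m (i :: w) = (U_(i) + s2m w)%MM.
Proof. by apply/mnmP=> j; rewrite mnmDE mnm1E !mnmE. Qed.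

Lemma abel_word w : abel (tens_word w) = 'X_[s2m w].
Proof.
rewrite /tens_word rmorph_prod /=; elim: w => [|i w IHw].
  by rewrite big_nil s2m_nil mpolyX0.
by rewrite big_cons IHw /= abel_gen sym_gen_basis s2m_cons mpolyXD.
Qed.

Lemma mdeg_s2m (w : word) : mdeg (s2m w) = size w.
Proof.
by elim: w => [|i w IHw]; rewrite ?s2m_nil ?mdeg0 // s2m_cons mdegD mdeg1 IHw.
Qed.

Lemma sort_monomialK : cancel sort_monomial abel.
Proof.
move=> x; rewrite [in RHS](mpolyE x) linear_sum /=.
by apply: eq_bigr => m _; rewrite linearZ /= abel_word s2mK.
Qed.

End Words.

(** * Skew group algebras and sums over the alternating group *)

Section SkewTensors.
Variables (k : comNzRingType) (gT : finGroupType) (A : algType k).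
Variable act : alg_action gT A.
Local Notation skew := (skew_alg act).

Definition skew_in (g : gT) (a : A) : skew := skew_tensor act a g.

Fact skew_in_linear g : linear (skew_in g).
Proof.
move=> a x y; apply/ffunP=> h; rewrite !ffunE.
by case: eqP => // _; rewrite scaler0 addr0.
Qed.
HB.instance Definition _ g :=
  GRing.isLinear.Build k A skew _ (skew_in g) (skew_in_linear g).

Lemma skew_inM g h a b :
  skew_in g a * skew_in h b = skew_in (g * h)%g (a * act g b).
Proof. exact: skew_tensorM. Qed.

Lemma skew_inE (x : skew) : x = \sum_g skew_in g (x g).
Proof.
apply/ffunP=> g; rewrite sum_ffunE (bigD1 g) //= ffunE eqxx big1 ?addr0 //.
by move=> h /negPf hg; rewrite ffunE eq_sym hg.
Qed.

Lemma sum_skew_inE (f : gT -> A) g : (\sum_h skew_in h (f h)) g = f g.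
Proof.
rewrite sum_ffunE (bigD1 g) //= ffunE eqxx big1 ?addr0 //.
by move=> h /negPf hg; rewrite ffunE eq_sym hg.
Qed.

End SkewTensors.

Section SumAlt3.
Variable M : nmodType.

Lemma sum_Alt3 (F : 'I_3 -> 'I_3 -> 'I_3 -> M) :
  \sum_(s in Alt 'I_3) F (s 0) (s 1) (s 2) = F 0 1 2 + F 1 2 0 + F 2 0 1.
Proof.
(* the cyclic shift, which is even because its cube is trivial *)
pose c : {perm 'I_3} := perm (@addIr _ (1 : 'I_3)).
have cE i : c i = i + 1 by rewrite permE.
have c3 : (c * c * c)%g = 1%g.
  apply/permP=> i; rewrite !permM !cE perm1.
  by apply/val_inj; case: i => [[|[|[|]]]].
have even_c : c \in Alt 'I_3.
  rewrite Alt_even; have := congr1 (@odd_perm 'I_3) c3.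
  by rewrite !odd_permM odd_perm1; case: (odd_perm c).
have c1 : c != 1%g by apply/eqP=> /permP/(_ 0); rewrite cE perm1.
have cc1 : (c * c)%g != 1%g.
  by apply/eqP=> /permP/(_ 0); rewrite permM !cE perm1.
have ccc : c != (c * c)%g.
  by apply/eqP=> /permP/(_ 0); rewrite permM !cE.
have AltE : Alt 'I_3 = 1%g |: (c |: [set (c * c)%g]) :> {set _}.
  apply/esym/eqP; rewrite eqEcard; apply/andP; split.
    apply/subsetP=> s; rewrite !in_setU !in_set1.
    by case/or3P=> /eqP->; rewrite ?group1 // groupM.
  have gt1 : (1 < #|'I_3|)%N by rewrite card_ord.
  have := card_Alt gt1; rewrite card_ord => card3.
  have -> : #|Alt 'I_3| = 3%N by apply/eqP; rewrite -(eqn_pmul2l (isT : 0 < 2)%N) card3.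
  by rewrite !cardsU1 cards1 !inE negb_or !(eq_sym 1%g) c1 cc1 ccc.
rewrite AltE !big_setU1 ?big_set1 ?inE ?negb_or ?(eq_sym 1%g) ?c1 ?cc1 ?ccc //=.
rewrite !permM !cE !perm1 addrA.
by congr (F _ _ _ + F _ _ _ + F _ _ _); apply/val_inj.
Qed.

End SumAlt3.

(** * Identities in modules and algebras *)

Section AbstractIdentities.
Variable k : fieldType.

Lemma scalar_subD (M : lmodType k) a (x y x' y' : M) :
  a *: x + y - (a *: x' + y') = a *: (x - x') + (y - y').
Proof. by rewrite opprD addrACA -scalerBr. Qed.

Lemma scalar_mulDl (A : algType k) a (x y z : A) :
  (a *: x + y) * z = a *: (x * z) + y * z.
Proof. by rewrite mulrDl scalerAl. Qed.

Lemma scalar_mulDr (A : algType k) a (x y z : A) :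
  z * (a *: x + y) = a *: (z * x) + z * y.
Proof. by rewrite mulrDr scalerAr. Qed.

(** Half of a swapped product is symmetric and half is a commutator. This is
    where the characteristic matters: only twice the difference has integral
    coefficients. *)
Lemma double_swap (R : pzRingType) (x x' u : R) :
  (x * u - u * x') *+ 2
  = ((x - x') * u + u * (x - x')) + ((x + x') * u - u * (x + x')).
Proof.
rewrite !mulrDl !mulrDr !mulNr !mulrN opprD mulr2n.
rewrite [RHS](AC ((2*2)*(2*2)) ((1*5)*(2*6)*(3*7)*(4*8))).
by rewrite /= addNr subrr !addr0 addrACA.
Qed.

Lemma jacobi_identity (R : pzRingType) (x y z : R) :
  (x * (y * z - z * y) - (y * z - z * y) * x)
  + (y * (z * x - x * z) - (z * x - x * z) * y)
  + (z * (x * y - y * x) - (x * y - y * x) * z) = 0.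
Proof.
rewrite !mulrBr !mulrBl !mulrA !opprD !opprK.
rewrite [LHS](AC ((2*2)*(2*2)*(2*2)) ((1*11)*(2*8)*(3*5)*(4*10)*(6*12)*(7*9))) /=.
by rewrite !(subrr, addNr) !addr0.
Qed.

Lemma comm_subr (R : pzRingType) (x y z : R) :
  x * (y - z) - (y - z) * x = (x * y - y * x) - (x * z - z * x).
Proof. by rewrite mulrBr mulrBl !opprD !opprK addrACA. Qed.

Lemma sum3B (M : zmodType) (x y z x' y' z' : M) :
  (x - x') + (y - y') + (z - z') = (x + y + z) - (x' + y' + z').
Proof. by rewrite [X in X + _]addrACA -opprD addrACA -opprD. Qed.

Lemma sub_chain (M : zmodType) (x y z t : M) :
  x - (y + z) + (z - t) = x - (y + t).
Proof. by rewrite !opprD !addrA subrK. Qed.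

Lemma cyclic_cancel (M : zmodType) (P1 P2 P3 P4 P5 P6 : M) :
  (P1 - P2) + (P3 - P4) + (P5 - P6) = 0 -> P6 - P3 + P2 = P1 - P4 + P5.
Proof.
move=> E; apply/eqP; rewrite eq_sym -subr_eq0 -E !opprD opprK.
by rewrite [X in X == _](AC (3*3) ((1*6)*(5*2)*(3*4))).
Qed.

Lemma sub_cancel (M : zmodType) (x y z : M) : (x - y) - (x - z) = z - y.
Proof. by rewrite opprB addrC addrA subrK. Qed.

Lemma sub_middle (M : zmodType) (x y z : M) : x + y + z - y = x + z.
Proof. by rewrite addrAC addrK. Qed.

Lemma sub_left (M : zmodType) (x y : M) : x + y - x = y.
Proof. by rewrite addrAC subrr add0r. Qed.

Lemma sandwich0 (M : zmodType) (x y z : M) : x = 0 -> z = 0 -> x + y + z = y.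
Proof. by move=> -> ->; rewrite add0r addr0. Qed.

Lemma sum_scale_sym (A : algType k) n (a b : 'I_n -> k)
    (f : 'I_n -> A) :
  (\sum_i a i *: f i) * (\sum_i b i *: f i)
  + (\sum_i b i *: f i) * (\sum_i a i *: f i)
  = \sum_i \sum_j (a i * b j + b i * a j) *: (f i * f j).
Proof.
rewrite !mulr_suml -big_split; apply: eq_bigr => i _.
rewrite !mulr_sumr -big_split; apply: eq_bigr => j _ /=.
by rewrite scalerDl -!scalerAl -!scalerAr !scalerA.
Qed.

Lemma gr_class_linear (A : filtered_algebra k) m : linear (@gr_class k A m).
Proof. exact: lquot_pi_linear. Qed.

Lemma subr0P (M : zmodType) (x y : M) : x = y <-> x - y = 0.
Proof. by split=> [->|/subr0_eq]; first exact: subrr. Qed.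

Lemma sub_zero (M : zmodType) (x y : M) : y = 0 -> x - y = x.
Proof. by move=> ->; rewrite subr0. Qed.

Lemma submodule_val0 (U : lmodType k) (P : submodClosed U) :
  val (0 : submodule P) = 0.
Proof. exact: (raddf0 val). Qed.

Lemma gr_class0 (A : filtered_algebra k) m : @gr_class k A m 0 = 0.
Proof.
by have := gr_class_linear (-1) (0 : submodule (fil_deg A m)) 0;
  rewrite scaler0 addr0 scaleN1r addNr.
Qed.

End AbstractIdentities.

(** * Commutators with the parameter function *)

(** The calculations only use an algebra R with a linear image of V and a
    multiplicative image of G, compatible with the action. The same
    hypotheses hold in T(V) # G and in each of its quotients. *)
Section Relations.
Variables (k : fieldType) (gT : finGroupType) (V : vectType k).
Variable rho : lin_action gT V.
Variable kappa : {bilinear V -> V -> {ffun gT -> k^o * V}}.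
Variables (R : algType k) (vec : {linear V -> R}) (grp : gT -> R).
Hypothesis grp1 : grp 1%g = 1.
Hypothesis grpM : forall g h, grp (g * h)%g = grp g * grp h.
Hypothesis grp_vec : forall g v, grp g * vec v = vec (rho g v) * grp g.

Local Notation param := {ffun gT -> k^o * V}.

Definition affine (q : k^o * V) : R := q.1%:A + vec q.2.

Fact affine_linear : linear affine.
Proof.
move=> a p q; rewrite /affine /= linearP scalerDr addrACA; congr (_ + _).
by rewrite scalerDl scalerA.
Qed.
HB.instance Definition _ :=
  GRing.isLinear.Build k (k^o * V)%type R _ affine affine_linear.

Definition param_elt (q : param) : R := \sum_g affine (q g) * grp g.

Fact param_elt_linear : linear param_elt.
Proof.
move=> a p q; rewrite /param_elt scaler_sumr -big_split; apply: eq_bigr => g _.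
by rewrite !ffunE (linearP affine) scalar_mulDl.
Qed.
HB.instance Definition _ :=
  GRing.isLinear.Build k param R _ param_elt param_elt_linear.

Definition relator (v w : V) : R :=
  vec v * vec w - vec w * vec v - param_elt (kappa v w).

Lemma relator_linearl w : linear (relator^~ w).
Proof.
move=> a u v; rewrite /relator linearP linearPl linearP.
by rewrite scalar_mulDl scalar_mulDr !scalar_subD.
Qed.

Lemma relator_linearr v : linear (relator v).
Proof.
move=> a u w; rewrite /relator linearP linearPr linearP.
by rewrite scalar_mulDl scalar_mulDr !scalar_subD.
Qed.

Lemma relator0l w : relator 0 w = 0.
Proof. by rewrite /relator (linear0l kappa) !raddf0 mul0r mulr0 addr0 subrr. Qed.

Lemma relator0r v : relator v 0 = 0.
Proof. by rewrite /relator (linear0r kappa) !raddf0 mul0r mulr0 addr0 subrr. Qed.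

Lemma param_elt_grp q h :
  param_elt q * grp h = param_elt [ffun g => q (g * h^-1)%g].
Proof.
rewrite /param_elt mulr_suml [RHS](reindex_inj (mulIg h)).
by apply: eq_bigr => g _; rewrite ffunE mulgK -mulrA -grpM.
Qed.

Lemma grp_param_elt q h :
  grp h * param_elt q
  = param_elt [ffun g => ((q (g ^ h)%g).1, rho h (q (g ^ h)%g).2)] * grp h.
Proof.
rewrite param_elt_grp /param_elt mulr_sumr [RHS](reindex_inj (mulgI h)).
apply: eq_bigr => g _; rewrite !ffunE conjgE mulgKV mulKg grpM !mulrA.
by congr (_ * _); rewrite /affine mulrDr mulrDl mulr_algl mulr_algr grp_vec.
Qed.

Lemma kappa_actE h v w :
  kappa_act rho kappa h (rho h v) (rho h w)
  = [ffun g => ((kappa v w (g ^ h)%g).1, rho h (kappa v w (g ^ h)%g).2)].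
Proof.
rewrite /kappa_act -!lin_actM mulVg !lin_act1.
apply/ffunP=> g; rewrite sum_ffunE (bigD1 (g ^ h)%g) //= !ffunE.
rewrite conjgE !mulgA mulgK mulgV mul1g eqxx big1 ?addr0 // => j jg.
rewrite ffunE; case: eqP => // gE; case/eqP: jg.
by rewrite gE !mulgA mulgKV mulVg mul1g.
Qed.

(** Conjugation by h sends a relation to the relation of the transformed vectors
    for the transformed parameter, hence relations to relations exactly when
    kappa is invariant. *)
Lemma grp_relator h v w :
  grp h * relator v w
  = (vec (rho h v) * vec (rho h w) - vec (rho h w) * vec (rho h v)
     - param_elt (kappa_act rho kappa h (rho h v) (rho h w))) * grp h.
Proof.
rewrite /relator !mulrBr !mulrBl !mulrA !grp_vec -!mulrA !grp_vec.
by rewrite grp_param_elt kappa_actE.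
Qed.

Definition sym_prod (u v : V) : R := vec u * vec v + vec v * vec u.

(** The coefficients of degree at most 1 of twice the commutator of x with the
    element of parameter q: the first summand collects kappa of the commutators
    created by symmetrising, and the second is the commutator of x with the
    scalar part of q. *)
Definition lower_part (x : V) (q : param) : param :=
  (\sum_h [ffun g => kappa (x + rho h x) (q h).2 (g * h^-1)%g])
  + [ffun g => (0, ((q g).1 *: (x - rho g x)) *+ 2)].

Lemma comm_affine x p g :
  vec x * (affine p * grp g) - affine p * grp g * vec x
  = (p.1 *: vec (x - rho g x) + (vec x * vec p.2 - vec p.2 * vec (rho g x)))
    * grp g.
Proof.
rewrite -[affine p * _ * _]mulrA grp_vec !mulrA -mulrBl; congr (_ * _).
rewrite /affine mulrDl mulrDr mulr_algl mulr_algr opprD addrACA.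
by rewrite -scalerBr -linearB.
Qed.

(** Apply [double_swap] with x' = gx in each degree g, because the group element
    g turns right multiplication by x into right multiplication by gx. *)
Lemma comm_param_elt x q :
  (vec x * param_elt q - param_elt q * vec x) *+ 2
  = \sum_g sym_prod (x - rho g x) (q g).2 * grp g
    + \sum_g relator (x + rho g x) (q g).2 * grp g + param_elt (lower_part x q).
Proof.
have -> : param_elt (lower_part x q)
    = \sum_h (param_elt (kappa (x + rho h x) (q h).2) * grp h
              + ((q h).1 *: vec (x - rho h x)) *+ 2 * grp h).
  rewrite linearD linear_sum big_split; congr (_ + _).
    by apply: eq_bigr => h _; rewrite param_elt_grp.
  rewrite /param_elt; apply: eq_bigr => h _; congr (_ * _).
  by rewrite ffunE /affine scale0r add0r linearMn linearZ.
(* the identity holds separately for each group element g *)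
rewrite {1 2}/param_elt mulr_sumr mulr_suml -sumrB -sumrMnl -!big_split.
apply: eq_bigr => g _ /=.
rewrite comm_affine -mulrnAl -!mulrDl; congr (_ * _).
rewrite mulrnDl double_swap addrC -!linearB -!linearD !addrA; congr (_ + _).
by rewrite subrK.
Qed.

Local Notation kap v w := (param_elt (kappa v w)).

(** The failure of the Jacobi identity for a bracket given by kappa. *)
Definition jacobiator (x y z : V) : R :=
  (vec x * kap y z - kap y z * vec x)
  + (vec y * kap z x - kap z x * vec y)
  + (vec z * kap x y - kap x y * vec z).

(** Each kappa is a commutator minus a relation, and the double commutators
    cancel by the Jacobi identity of R. *)
Lemma jacobiator_relators x y z :
  jacobiator x y z
  = - ((vec x * relator y z - relator y z * vec x)
       + (vec y * relator z x - relator z x * vec y)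
       + (vec z * relator x y - relator x y * vec z)).
Proof.
rewrite /jacobiator /relator (comm_subr _ _ (kap y z)) (comm_subr _ _ (kap z x)).
rewrite (comm_subr _ _ (kap x y)).
by rewrite [in RHS]sum3B jacobi_identity sub0r opprK.
Qed.

Definition lower_jacobiator (x y z : V) : param :=
  lower_part x (kappa y z) + lower_part y (kappa z x) + lower_part z (kappa x y).

Lemma twice_jacobiator x y z :
  jacobiator x y z *+ 2
  = \sum_g (sym_prod (x - rho g x) (kappa y z g).2
            + sym_prod (y - rho g y) (kappa z x g).2
            + sym_prod (z - rho g z) (kappa x y g).2) * grp g
    + (\sum_g relator (x + rho g x) (kappa y z g).2 * grp g
       + \sum_g relator (y + rho g y) (kappa z x g).2 * grp g
       + \sum_g relator (z + rho g z) (kappa x y g).2 * grp g)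
    + param_elt (lower_jacobiator x y z).
Proof.
rewrite /jacobiator 2!mulrnDl !comm_param_elt !linearD /=.
rewrite [LHS](AC (3*3*3) ((1*4*7)*(2*5*8)*(3*6*9))) /=; congr (_ + _ + _).
by rewrite -!big_split; apply: eq_bigr => g _; rewrite !mulrDl.
Qed.

(** * Normal forms for the relations *)

Local Notation n := (\dim {:V}).
Local Notation e := (vbasis {:V}).
Local Notation word := (seq 'I_n).

Definition word_vec (w : word) : R := \prod_(i <- w) vec e`_i.

Lemma word_vec_cat w1 w2 : word_vec (w1 ++ w2) = word_vec w1 * word_vec w2.
Proof. exact: big_cat. Qed.

Lemma word_vec_nil : word_vec [::] = 1.
Proof. exact: big_nil. Qed.

Lemma word_vec_cons i w : word_vec (i :: w) = vec e`_i * word_vec w.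
Proof. exact: big_cons. Qed.

(** The filtration by degree, generated inductively to reason on one word at a
    time. *)
Inductive spanned (m : nat) : R -> Prop :=
| Spanned0 : spanned m 0
| SpannedD a w g x : (size w <= m)%N -> spanned m x ->
    spanned m (a *: (word_vec w * grp g) + x).

Lemma spannedP m a x y : spanned m x -> spanned m y -> spanned m (a *: x + y).
Proof.
elim=> [|b w g {}x wm _ IHx] my; first by rewrite scaler0 add0r.
by rewrite scalerDr scalerA -addrA; apply: SpannedD => //; apply: IHx.
Qed.

Lemma spanned_word m w g : (size w <= m)%N -> spanned m (word_vec w * grp g).
Proof.
move=> wm; rewrite -[X in spanned m X]addr0 -[X in X + 0]scale1r.
by apply: SpannedD => //; apply: Spanned0.
Qed.

Lemma spannedD m x y : spanned m x -> spanned m y -> spanned m (x + y).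
Proof. by move=> mx my; rewrite -[x]scale1r; apply: spannedP. Qed.

Lemma spannedB m x y : spanned m x -> spanned m y -> spanned m (x - y).
Proof. by move=> mx my; rewrite addrC -scaleN1r; apply: spannedP. Qed.

Lemma spannedZ m a x : spanned m x -> spanned m (a *: x).
Proof. by move=> mx; rewrite -[_ *: _]addr0; apply: spannedP => //; left. Qed.

Lemma spanned_sum m (I : finType) (F : I -> R) :
  (forall i, spanned m (F i)) -> spanned m (\sum_i F i).
Proof. by move=> mF; elim/big_ind: _ => //; [left | apply: spannedD]. Qed.

Lemma spannedW m p x : (m <= p)%N -> spanned m x -> spanned p x.
Proof.
move=> mp; elim=> [|a w g {}x wm _]; first by left.
by apply: SpannedD; apply: leq_trans mp.
Qed.

Lemma spanned_vecM m v x : spanned m x -> spanned m.+1 (vec v * x).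
Proof.
move=> mx; elim/basis_ind: v => [|a u v mu mv|i].
- by rewrite raddf0 mul0r; left.
- by rewrite linearP scalar_mulDl; apply: spannedP.
elim: mx => [|a w g {}x wm _ IHx]; first by rewrite mulr0; left.
rewrite scalar_mulDr mulrA -word_vec_cons; exact: SpannedD.
Qed.

Lemma spanned_grp m g : spanned m (grp g).
Proof. by rewrite -[grp g]mul1r -word_vec_nil; apply: spanned_word. Qed.

Lemma spanned_grpM m g x : spanned m x -> spanned m (grp g * x).
Proof.
elim=> [|a w h {}x wm _ IHx]; first by rewrite mulr0; left.
rewrite scalar_mulDr; apply: spannedP => //; apply: spannedW wm _.
elim: w => [|i w IHw].
  by rewrite word_vec_nil mul1r -grpM; apply: spanned_grp.
by rewrite word_vec_cons !mulrA grp_vec -!mulrA; apply/spanned_vecM.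
Qed.

Lemma spannedM i j x y : spanned i x -> spanned j y -> spanned (i + j) (x * y).
Proof.
move=> + jy; elim=> [|a w g {}x wi _ IHx]; first by rewrite mul0r; left.
rewrite scalar_mulDl; apply: spannedP => //.
have {wi} : (size w + j <= i + j)%N by rewrite leq_add2r.
move/spannedW; apply; rewrite -mulrA; have := spanned_grpM g jy.
move: (grp g * y) => z mz; elim: w => [|l w IHw].
  by rewrite word_vec_nil mul1r.
by rewrite word_vec_cons -mulrA; apply: spanned_vecM.
Qed.

Lemma spanned1 m : spanned m 1.
Proof. by rewrite -grp1; apply: spanned_grp. Qed.

Lemma spanned_vec v : spanned 1 (vec v).
Proof. by rewrite -[vec v]mulr1; apply/spanned_vecM/spanned1. Qed.

Lemma spanned_word_vec w : spanned (size w) (word_vec w).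
Proof. by rewrite -[word_vec w]mulr1 -grp1; apply: spanned_word. Qed.

Lemma spanned_param_elt q : spanned 1 (param_elt q).
Proof.
apply: spanned_sum => g; rewrite -[1%N]addn0; apply: spannedM; last exact: spanned_grp.
apply: spannedD; last exact: spanned_vec.
by apply/spannedZ/spanned1.
Qed.

Section NormalForm.
Variable M : lmodType k.

(** The factors a and b carry degree bounds so that only relations of total
    degree at most m are concerned; this is what an induction on the degree can
    provide. *)
Definition kills (m : nat) (N : R -> M) : Prop :=
  forall i j a b v w, spanned i a -> spanned j b -> (i + j + 2 <= m)%N ->
    N (a * relator v w * b) = 0.

Lemma killsW m p N : (m <= p)%N -> kills p N -> kills m N.
Proof. by move=> mp kN i j a b v w ia jb le; apply: (kN i j) (leq_trans le mp). Qed.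

(** An element killed by all maps that respect the relations up to a large
    enough degree. The factors a and b are part of the definition to make the
    negligible elements an ideal. *)
Definition negligible (t : R) : Prop :=
  exists m, forall i j a b (N : {linear R -> M}),
    spanned i a -> spanned j b -> kills (m + i + j) N -> N (a * t * b) = 0.

Hypothesis spanning : forall t, exists m, spanned m t.

Lemma negligible_ideal : two_sided_ideal negligible.
Proof.
split.
- by exists 0%N => i j a b N _ _ _; rewrite mulr0 mul0r linear0.
- move=> x y [m1 neg1] [m2 neg2]; exists (maxn m1 m2) => i j a b N ia jb kN.
  rewrite mulrBr mulrBl linearB /= (neg1 i j) ?(neg2 i j) ?subr0 //.
    by apply: killsW kN; rewrite !leq_add2r leq_maxr.
  by apply: killsW kN; rewrite !leq_add2r leq_maxl.
- move=> a' x [m neg]; have [p pa'] := spanning a'.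
  exists (m + p)%N => i j a b N ia jb kN; rewrite mulrA.
  apply: (neg (i + p)%N j) => //; first exact: spannedM.
  by apply: killsW kN; lia.
- move=> b' x [m neg]; have [p pb'] := spanning b'.
  exists (m + p)%N => i j a b N ia jb kN; rewrite mulrA -[_ * b' * b]mulrA.
  apply: (neg i (p + j)%N) => //; first exact: spannedM.
  by apply: killsW kN; lia.
Qed.

Lemma negligible_relator v w : negligible (relator v w).
Proof.
by exists 2%N => i j a b N ia jb kN; apply: (kN i j) => //; rewrite addnC addnA.
Qed.

Variable base : word -> gT -> M.
Hypothesis two_neq0 : (2%:R : k) != 0.
Hypothesis kappa_alt : forall v, kappa v v = 0.
Hypothesis words_free : forall f : word -> gT -> M,
  exists N : {linear R -> M}, forall w g, N (word_vec w * grp g) = f w g.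
Hypothesis relator_inv : forall h v w,
  grp h * relator v w = relator (rho h v) (rho h w) * grp h.

Hypothesis jacobi : forall x y z,
  jacobiator x y z *+ 2
  = \sum_g relator (x + rho g x) (kappa y z g).2 * grp g
    + \sum_g relator (y + rho g y) (kappa z x g).2 * grp g
    + \sum_g relator (z + rho g z) (kappa x y g).2 * grp g.

Lemma kappa_anti v w : kappa w v = - kappa v w.
Proof.
apply/eqP; rewrite -addr_eq0 addrC; have := kappa_alt (v + w).
by rewrite linearDl !linearDr !kappa_alt add0r addr0 => ->.
Qed.

Lemma kills_swap m (N : {linear R -> M}) i j a b v w :
    kills m N -> spanned i a -> spanned j b -> (i + j + 2 <= m)%N ->
  N (a * (vec v * vec w) * b)
  = N (a * (vec w * vec v) * b) + N (a * kap v w * b).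
Proof.
move=> kN ia jb le; have /eqP := kN i j a b v w ia jb le.
by rewrite /relator !mulrBr !mulrBl !linearB /= -addrA -opprD subr_eq0 => /eqP.
Qed.

(** Twice the Jacobiator is a combination of relations times group elements,
    which are of degree 2 and not 3, so that the bound on the degree of [kills]
    suffices; then divide by 2. *)
Lemma kills_jacobiator m (N : {linear R -> M}) i j a b x y z :
    kills m N -> spanned i a -> spanned j b -> (i + j + 2 <= m)%N ->
  N (a * jacobiator x y z * b) = 0.
Proof.
move=> kN ia jb le; have: N (a * (jacobiator x y z *+ 2) * b) = 0.
  rewrite jacobi !mulrDr !mulrDl !linearD /= !mulr_sumr !mulr_suml !linear_sum /=.
  rewrite !big1 ?addr0 // => g _; rewrite !mulrA -mulrA; apply: (kN i j) => //;
    exact: spanned_grpM.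
rewrite mulrnAr mulrnAl linearMn -scaler_nat => /eqP.
by rewrite scaler_eq0 (negPf two_neq0) => /eqP.
Qed.

Section Step.
Variables (m : nat) (N' : {linear R -> M}).
Hypothesis kN' : kills m N'.

(** The value that exchanging x and y must contribute, computed with the map of
    the previous degree. *)
Definition correction g a x y b : M :=
  N' (word_vec a * kap e`_(x : 'I_n) e`_(y : 'I_n) * (word_vec b * grp g)).

(** Both sides reduce to the term where the two pairs are replaced by their
    kappa: exchange x', y' next to kappa(x,y) on one side and x, y next to
    kappa(x',y') on the other. *)
Lemma correction_far g a x y d x' y' b :
    size (a ++ x :: y :: d ++ x' :: y' :: b) = m.+1 ->
  correction g a x y (d ++ x' :: y' :: b) + correction g (a ++ y :: x :: d) x' y' b
  = correction g (a ++ x :: y :: d) x' y' b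
    + correction g a x y (d ++ y' :: x' :: b).
Proof.
rewrite !size_cat /= size_cat /= => sz.
have swap1 := @kills_swap m N' (size a + 1 + size d) (size b)
  (word_vec a * kap e`_x e`_y * word_vec d) (word_vec b * grp g) e`_x' e`_y' kN'.
have swap2 := @kills_swap m N' (size a) (size d + 1 + size b) (word_vec a)
  (word_vec d * kap e`_x' e`_y' * (word_vec b * grp g)) e`_x e`_y kN'.
rewrite /correction !(word_vec_cat, word_vec_cons) !mulrA.
rewrite !mulrA in swap1 swap2.
rewrite swap1 ?swap2; last 6 first.
- exact: spanned_word_vec.
- rewrite -mulrA; apply: spannedM; last exact: spanned_word.
  by apply: spannedM; [apply: spanned_word_vec | apply: spanned_param_elt].
- by lia.
- apply: spannedM; last exact: spanned_word_vec.
  by apply: spannedM; [apply: spanned_word_vec | apply: spanned_param_elt].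
- exact: spanned_word.
- by lia.
by rewrite addrC -[RHS]addrA; congr (_ + _); rewrite addrC.
Qed.

(** The difference of the two sides is the value at the Jacobiator of the three
    letters. *)
Lemma correction_braid g a x y z b :
    size (a ++ x :: y :: z :: b) = m.+1 ->
  correction g a x y (z :: b) + correction g (rcons a y) x z b
    + correction g a y z (x :: b)
  = correction g (rcons a x) y z b + correction g a x z (y :: b)
    + correction g (rcons a z) x y b.
Proof.
rewrite size_cat /= => sz.
have := @kills_jacobiator m N' (size a) (size b) (word_vec a) (word_vec b * grp g)
  e`_x e`_y e`_z kN' (spanned_word_vec _) (spanned_word _ (leqnn _)).
rewrite /jacobiator !(mulrDr, mulrN) !(mulrDl, mulNr) !(raddfD, raddfN) /= => jac.
have {}jac := cyclic_cancel (jac ltac:(lia)).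
rewrite /correction -!cats1 !(word_vec_cat, word_vec_cons) !word_vec_nil !mulr1.
rewrite (kappa_anti e`_z e`_x) !linearN /= !mulrN !mulNr !linearN /= !mulrA.
by rewrite !mulrA in jac.
Qed.

Lemma correction_anti g a x y b : correction g a y x b = - correction g a x y b.
Proof.
by rewrite /correction kappa_anti linearN mulrN mulNr linearN.
Qed.

Lemma correction_diag g a x b : correction g a x x b = 0.
Proof. by rewrite /correction kappa_alt linear0 mulr0 mul0r linear0. Qed.

Definition next_value (w : word) (g : gT) : M :=
  if (size w <= m)%N then N' (word_vec w * grp g)
  else sort_value (base^~ g) (correction g) w.

End Step.

(** Induction on the degree. The new map agrees with the old one on words of
    length at most m and is given by sorting on longer words; since corrections
    have degree at most m, it kills the relations between basis vectors in
    degree m + 1, hence all relations by bilinearity. A group element in front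
    of a relation is moved to its right by invariance. *)
Lemma normal_form m : exists N : {linear R -> M},
  (forall w g, weakly_increasing w -> N (word_vec w * grp g) = base w g)
  /\ kills m N.
Proof.
elim: m => [|m [N' [N'base kN']]].
  have [N NE] := words_free base; exists N; split=> [w g _|i j a b v w _ _].
    exact: NE.
  by rewrite addn2.
have [N NE] := words_free (next_value m N').
have NN' x : spanned m x -> N x = N' x.
  elim=> [|a w g {}x wm _ IHx]; first by rewrite !linear0.
  by rewrite !linearP NE /next_value wm IHx.
exists N; split=> [w g sw|].
  rewrite NE /next_value; case: ifP => _; first exact: N'base.
  exact: sort_value_sorted.
have basic a (x y : 'I_n) b g : (size a + size b).+1 = m ->
    N (word_vec a * relator e`_x e`_y * (word_vec b * grp g)) = 0.
  move=> sz.
  have szE (u v : 'I_n) : size (a ++ u :: v :: b) = m.+1.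
    by rewrite size_cat /= -sz !addnS.
  have wE (u v : 'I_n) : word_vec a * (vec e`_u * vec e`_v) * (word_vec b * grp g)
      = word_vec (a ++ u :: v :: b) * grp g.
    by rewrite word_vec_cat !word_vec_cons !mulrA.
  rewrite /relator !mulrBr !mulrBl !linearB /= !wE !NE /next_value !szE ltnn.
  rewrite (@sort_value_swap _ _ _ (correction N' g) m.+1) //; last first.
  - by move=> *; apply: correction_diag.
  - by move=> *; apply: correction_anti.
  - by move=> a1 x1 y1 z b1; apply: correction_braid.
  - by move=> a1 x1 y1 d x2 y2 b1; apply: correction_far.
  rewrite [X in X - _]addrAC subrr add0r NN' ?subrr // -sz -addn1 addnAC.
  apply: spannedM; last exact: spanned_word.
  by apply: spannedM; [apply: spanned_word_vec | apply: spanned_param_elt].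
have vectors a b g v w : (size a + size b).+1 = m ->
    N (word_vec a * relator v w * (word_vec b * grp g)) = 0.
  move=> sz; elim/basis_ind: v w => [w|c u v Nu Nv w|x].
  - by rewrite relator0l mulr0 mul0r linear0.
  - by rewrite relator_linearl scalar_mulDr scalar_mulDl linearP Nu Nv scaler0 addr0.
  elim/basis_ind=> [|c u v Nu Nv|y]; last exact: basic.
  - by rewrite relator0r mulr0 mul0r linear0.
  - by rewrite relator_linearr scalar_mulDr scalar_mulDl linearP Nu Nv scaler0 addr0.
move=> i j a b v w ia jb le.
have spr v' w' : spanned 2 (relator v' w').
  apply: spannedB; last by apply: (@spannedW 1) => //; apply: spanned_param_elt.
  by apply: spannedB; apply: (@spannedM 1 1); apply: spanned_vec.
have [lt|ge] := leqP (i + j + 2) m.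
  rewrite NN'; first exact: (kN' i j).
  apply: spannedW lt _; rewrite addnAC; apply: spannedM => //; exact: spannedM.
elim: ia => [|c w1 h {}a w1i _ IHa]; first by rewrite !mul0r linear0.
rewrite scalar_mulDl [(_ + _) * b]scalar_mulDl linearP IHa addr0.
rewrite -[word_vec w1 * _ * _]mulrA relator_inv mulrA -[_ * grp h * b]mulrA.
have := spanned_grpM h jb; move: (grp h * b) (rho h v) (rho h w) => b' v' w' jb'.
(* b' has absorbed the group element of a, so words suffice on the left *)
suff -> : N (word_vec w1 * relator v' w' * b') = 0 by rewrite scaler0.
elim: jb' => [|c' w2 h' {}b' w2j _ IHb]; first by rewrite mulr0 linear0.
rewrite scalar_mulDr linearP IHb addr0.
have [lt|ge'] := leqP (size w1 + size w2 + 2) m; last first.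
  by rewrite vectors ?scaler0 //; lia.
rewrite NN'; last first.
  apply: spannedW lt _; rewrite addnAC.
  apply: spannedM; last exact: spanned_word.
  by apply: spannedM => //; apply: spanned_word_vec.
rewrite (kN' (size w1) (size w2)) ?scaler0 //; first exact: spanned_word_vec.
exact: spanned_word.
Qed.

Lemma negligible_normal_form t : negligible t -> exists N : {linear R -> M},
  (forall w g, weakly_increasing w -> N (word_vec w * grp g) = base w g)
  /\ N t = 0.
Proof.
move=> [m neg]; have [N [Nbase kN]] := normal_form m; exists N; split=> //.
have := neg 0%N 0%N 1 1 N (spanned1 0) (spanned1 0).
by rewrite mul1r mulr1 !addn0; apply.
Qed.

End NormalForm.

Section Reordering.
Variable I : R -> Prop.
Hypotheses (idealI : two_sided_ideal I) (I_relator : forall v w, I (relator v w)).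

(** Degree strictly less than m, with the zero space for m = 0, as in the
    filtration of the associated graded algebra. *)
Definition spanned_below (m : nat) (x : R) : Prop :=
  if m is m'.+1 then spanned m' x else x = 0.

Lemma idealD x y : I x -> I y -> I (x + y).
Proof.
have [I0 IB _ _] := idealI => Ix Iy.
by rewrite -[y]opprK; apply: (IB) => //; rewrite -sub0r; apply: IB.
Qed.

(** Exchanging a descent changes the word by a relation and by a term containing
    kappa, whose degree is smaller. *)
Lemma reorder_word w g : exists2 r, spanned_below (size w) r
  & I (word_vec w * grp g - (word_vec (m2s (s2m w)) * grp g + r)).
Proof.
have [I0 IB Il Ir] := idealI.
have [d] := ubnP (inversions w); elim: d w => // d IHd w inv_w.
case E: (first_descent w) => [[[[a x] y] b]|]; last first.
  exists 0; first by case: (size w) => //= m; left.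
  by rewrite addr0 m2s_s2m ?subrr // first_descent_none.
have [wE yx] := first_descent_some E.
have perm_w : s2m w = s2m (a ++ y :: x :: b).
  by apply/mnmP=> i; rewrite wE !mnmE !count_cat /= [X in (_ + X = _)%N]addnCA.
have size_w : size w = (size a + 1 + size b).+1.
  by rewrite wE size_cat /= addn1 addSn !addnS.
rewrite wE inversions_swap // in inv_w.
have [r' r'lt Ir'] := IHd _ inv_w.
have {}r'lt : spanned (size a + 1 + size b) r'.
  by move: r'lt; rewrite size_cat /= !addnS addn0 addSn.
exists (word_vec a * kap e`_x e`_y * (word_vec b * grp g) + r').
  rewrite size_w /=; apply: spannedD => //; apply: spannedM; last exact: spanned_word.
  by apply: spannedM; [apply: spanned_word_vec | apply: spanned_param_elt].
rewrite perm_w; set s := word_vec (m2s _) * _ in Ir' *.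
have Ixy : I (word_vec a * relator e`_x e`_y * (word_vec b * grp g)).
  by apply: Ir; apply: Il.
have := idealD Ixy Ir'; rewrite wE /relator !mulrBr !mulrBl.
rewrite !word_vec_cat !word_vec_cons !mulrA.
set A := _ * _ * vec e`_y * _ * _; set B := _ * vec e`_x * _ * _.
set C := _ * _ * _ * _.
rewrite [A - B - C]addrAC addrA subrK => IA.
by rewrite [s + _]addrC -addrA opprD addrA [r' + s]addrC.
Qed.

End Reordering.

End Relations.

(** * The algebra H and its associated graded algebra *)

Section Concrete.
Variables (k : fieldType) (gT : finGroupType) (V : vectType k).
Variable rho : lin_action gT V.
Variable kappa : {bilinear V -> V -> {ffun gT -> k^o * V}}.

Local Notation n := (\dim {:V}).
Local Notation e := (vbasis {:V}).
Local Notation word := (seq 'I_n).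
Local Notation T := (tens_alg V).
Local Notation S := (sym_alg V).
Local Notation TG := (skew_alg (tens_act rho)).
Local Notation SG := (skew_alg (sym_act rho)).
Local Notation inT := (skew_in (tens_act rho)).
Local Notation inS := (skew_in (sym_act rho)).
Local Notation TG_le m := (@skew_over k gT _ (tens_act rho) (@tens_le k V m)).

Definition vecT (v : V) : TG := inT 1%g (tens_gen v).

Fact vecT_linear : linear vecT.
Proof. by move=> a u v; rewrite /vecT linearP (linearP (inT 1%g)). Qed.
HB.instance Definition _ := GRing.isLinear.Build k V TG _ vecT vecT_linear.

Definition grpT (g : gT) : TG := inT g 1.

Lemma inT_mul_grp a g : inT 1%g a * grpT g = inT g a.
Proof. by rewrite /grpT skew_inM mul1g rmorph1 mulr1. Qed.

Lemma grpT1 : grpT 1%g = 1.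
Proof. by []. Qed.

Lemma grpTM g h : grpT (g * h)%g = grpT g * grpT h.
Proof. by rewrite /grpT skew_inM rmorph1 mulr1. Qed.

Lemma grpT_vec g v : grpT g * vecT v = vecT (rho g v) * grpT g.
Proof.
rewrite /vecT inT_mul_grp /grpT skew_inM mulg1 mul1r.
congr (inT g _); exact: tens_act_gen.
Qed.

Lemma word_vecT w : word_vec vecT w = inT 1%g (tens_word w).
Proof.
elim: w => [|i w IHw]; first by rewrite /tens_word word_vec_nil big_nil.
rewrite word_vec_cons IHw /vecT skew_inM mulg1 alg_act1.
by rewrite /tens_word big_cons.
Qed.

Lemma word_eltE w g : word_vec vecT w * grpT g = inT g (tens_word w).
Proof. by rewrite word_vecT inT_mul_grp. Qed.

Lemma param_eltE q :
  param_elt vecT grpT q = \sum_g inT g ((q g).1%:A + tens_gen (q g).2).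
Proof.
rewrite /param_elt; apply: eq_bigr => g _; rewrite -inT_mul_grp; congr (_ * _).
by rewrite /affine (linearD (inT 1%g)) (linearZ_LR (inT 1%g)).
Qed.

Lemma kappa_tensE v w : kappa_tens rho kappa v w = param_elt vecT grpT (kappa v w).
Proof. by rewrite param_eltE. Qed.

Lemma H_relE (r : TG) : H_rel kappa r <-> exists v w, r = relator kappa vecT grpT v w.
Proof.
by split=> -[v [w ->]]; exists v, w; rewrite /relator -kappa_tensE.
Qed.

Lemma spanned_le m (x : TG) :
  spanned vecT grpT m x <-> x \in TG_le m.
Proof.
split.
  elim=> [|a w g {}x wm _ IHx]; first exact: rpred0.
  rewrite rpredD // rpredZ // word_eltE.
  apply/skew_overP=> h; rewrite ffunE; case: eqP => _; last exact: rpred0.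
  exact: tens_leW wm (tens_word_le _).
move=> /skew_overP mx; rewrite [x]skew_inE; apply: spanned_sum => g.
move: (x g) (mx g) => {mx}{}x; elim/tens_le_ind => [|a y z my mz|w wm].
- by rewrite linear0; left.
- by rewrite (linearP (inT g)); apply: spannedP.
- by rewrite -word_eltE; apply: spanned_word.
Qed.

Lemma spanned_exhaust (x : TG) : exists m, spanned vecT grpT m x.
Proof.
exists (\max_g \max_(w <- monalg.msupp (x g)) fdeg w)%N.
apply/spanned_le/skew_overP => g; apply/tens_leP=> w wx.
apply: leq_trans (leq_bigmax g).
by rewrite (big_fsetD1 w) //= leq_maxl.
Qed.

Section WordsFree.
Variables (M : lmodType k) (f : word -> gT -> M).

Definition skew_extend (x : TG) : M := \sum_g word_extend (f^~ g) (x g).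

Fact skew_extend_linear : linear skew_extend.
Proof.
move=> a x y; rewrite /skew_extend scaler_sumr -big_split.
apply: eq_bigr => g _; have -> : (a *: x + y) g = a *: x g + y g by rewrite !ffunE.
exact: linearP.
Qed.
HB.instance Definition _ :=
  GRing.isLinear.Build k TG M _ skew_extend skew_extend_linear.

Lemma skew_extend_word w g : skew_extend (word_vec vecT w * grpT g) = f w g.
Proof.
rewrite word_eltE /skew_extend (bigD1 g) //= ffunE eqxx word_extend_word.
by rewrite big1 ?addr0 // => h /negPf hg; rewrite ffunE hg linear0.
Qed.

End WordsFree.

Lemma words_freeT (M : lmodType k) (f : word -> gT -> M) :
  exists N : {linear TG -> M}, forall w g, N (word_vec vecT w * grpT g) = f w g.
Proof. by exists (skew_extend f) => w g; apply: skew_extend_word. Qed.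

(** Only linear, and not equivariant: the action of G does not respect the
    order of the basis vectors. *)
Definition sort_elt (x : SG) : TG := \sum_g inT g (sort_monomial (x g)).

Fact sort_elt_linear : linear sort_elt.
Proof.
move=> a x y; rewrite /sort_elt scaler_sumr -big_split.
apply: eq_bigr => g _; have -> : (a *: x + y) g = a *: x g + y g by rewrite !ffunE.
by rewrite (linearP (@sort_monomial k V)) (linearP (inT g)).
Qed.
HB.instance Definition _ := GRing.isLinear.Build k SG TG _ sort_elt sort_elt_linear.

Definition abelT (x : TG) : SG := \sum_g inS g (abel (x g)).

Fact abelT_linear : linear abelT.
Proof.
move=> a x y; rewrite /abelT scaler_sumr -big_split.
apply: eq_bigr => g _; have -> : (a *: x + y) g = a *: x g + y g by rewrite !ffunE.
by rewrite (linearP (@abel k V)) (linearP (inS g)).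
Qed.
HB.instance Definition _ := GRing.isLinear.Build k TG SG _ abelT abelT_linear.

Lemma abelTE x g : abelT x g = abel (x g).
Proof. exact: sum_skew_inE. Qed.

Lemma sort_eltE x g : sort_elt x g = sort_monomial (x g).
Proof. exact: sum_skew_inE. Qed.

Lemma abelT_in g x : abelT (inT g x) = inS g (abel x).
Proof.
by apply/ffunP=> h; rewrite abelTE !ffunE; case: eqP => // _; rewrite linear0.
Qed.

Lemma sort_elt_in g p : sort_elt (inS g p) = inT g (sort_monomial p).
Proof.
by apply/ffunP=> h; rewrite sort_eltE !ffunE; case: eqP => // _; rewrite linear0.
Qed.

Lemma sort_eltK : cancel sort_elt abelT.
Proof. by move=> x; apply/ffunP=> g; rewrite abelTE sort_eltE sort_monomialK. Qed.

Lemma abel_act g x : abel (tens_act rho g x) = sym_act rho g (abel x).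
Proof.
have := @tens_ext k V S (@abel k V \o tens_act rho g) (sym_act rho g \o @abel k V).
apply=> v /=; rewrite abel_gen.
transitivity (sym_gen (rho g v)); last exact/esym/sym_act_gen.
rewrite -abel_gen; congr (abel _); exact: tens_act_gen.
Qed.

Lemma abelTM x y : abelT (x * y) = abelT x * abelT y.
Proof.
apply/ffunP=> g; rewrite abelTE !ffunE linear_sum; apply: eq_bigr => h _.
rewrite !abelTE rmorphM; congr (_ * _); exact: abel_act.
Qed.
Lemma sort_elt_sum (x : SG) : sort_elt x
  = \sum_g \sum_(m <- msupp (x g)) (x g)@_m *: (word_vec vecT (m2s m) * grpT g).
Proof.
rewrite /sort_elt; apply: eq_bigr => g _; rewrite /sort_monomial linear_sum.
by apply: eq_bigr => m _; rewrite word_eltE linearZ_LR.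
Qed.

Local Notation H := (H_alg rho kappa).
Local Notation I := (@ideal_gen k TG (@H_rel k gT V rho kappa)).
Local Notation pi := (@quot_alg_pi k TG (@H_rel k gT V rho kappa)).

(** The linear independence of the sorted words times group elements in H. *)
Definition pbw : Prop := forall x : SG, sort_elt x \in I -> x = 0.

Lemma pi_eqP (x y : TG) : reflect (pi x = pi y) (x - y \in I).
Proof. exact: lquot_eqP. Qed.

Lemma pi_eq0 (x : TG) : (x \in I) <-> pi x = 0.
Proof.
rewrite -[x in x \in _]subr0; split=> [/pi_eqP->|x0]; first exact: linear0.
by apply/pi_eqP; rewrite x0 linear0.
Qed.

Lemma ideal_two_sided : two_sided_ideal (fun x : TG => x \in I).
Proof.
split=> [|x y|a x|a x]; [exact: rpred0 | exact: rpredB | exact: ideal_gen_mull |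
  exact: ideal_gen_mulr].
Qed.

Lemma ideal_relator v w : relator kappa vecT grpT v w \in I.
Proof.
by apply/ideal_genP=> J _; apply; apply/H_relE; exists v, w.
Qed.

(** The values of the normal form are taken in S # G itself, with the sorted
    word of a monomial sent to that monomial, so that the normal form is a left
    inverse of sorting. *)
Lemma normal_form_pbw :
    (2%:R : k) != 0 -> (forall v, kappa v v = 0) ->
    (forall h v w, grpT h * relator kappa vecT grpT v w
       = relator kappa vecT grpT (rho h v) (rho h w) * grpT h) ->
    (forall x y z, jacobiator kappa vecT grpT x y z *+ 2
      = \sum_g relator kappa vecT grpT (x + rho g x) (kappa y z g).2 * grpT g
        + \sum_g relator kappa vecT grpT (y + rho g y) (kappa z x g).2 * grpT g
        + \sum_g relator kappa vecT grpT (z + rho g z) (kappa x y g).2 * grpT g) ->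
  pbw.
Proof.
move=> two_neq0 alt inv jac x /ideal_genP Ix.
pose base (w : word) g : SG := inS g 'X_[s2m w].
have [N [Nbase Nx]] : exists N : {linear TG -> SG},
    (forall w g, weakly_increasing w -> N (word_vec vecT w * grpT g) = base w g)
    /\ N (sort_elt x) = 0.
  apply: (negligible_normal_form grpT1 grpTM grpT_vec base two_neq0 alt
    (words_freeT (M := SG)) inv jac).
  apply: Ix => [|r /H_relE[v [w ->]]].
    exact: (negligible_ideal kappa grpTM grpT_vec SG spanned_exhaust).
  exact: negligible_relator.
rewrite -Nx sort_elt_sum linear_sum [LHS]skew_inE; apply: eq_bigr => g _.
rewrite [in LHS](mpolyE (x g)) !linear_sum; apply: eq_bigr => m _.
rewrite linearZ_LR [RHS]linearZ_LR Nbase; last exact: weakly_increasing_m2s.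
by rewrite /base s2mK.
Qed.

Definition SG_below (m : nat) (x : SG) : Prop := forall g, (msize (x g) <= m)%N.

Local Notation spannedT := (spanned vecT grpT).
Local Notation spannedT_below := (spanned_below vecT grpT).

Lemma SG_belowP m a x y : SG_below m x -> SG_below m y -> SG_below m (a *: x + y).
Proof.
move=> mx my g; have -> : (a *: x + y) g = a *: x g + y g by rewrite !ffunE.
apply: leq_trans (msizeD_le _ _) _; rewrite geq_max my andbT.
exact: leq_trans (msizeZ_le _ _) (mx g).
Qed.

Lemma SG_below0 m : SG_below m 0.
Proof. by move=> g; rewrite ffunE msize0. Qed.

Lemma SG_belowB m x y : SG_below m x -> SG_below m y -> SG_below m (x - y).
Proof. by move=> mx my; rewrite addrC -scaleN1r; apply: SG_belowP. Qed.

Lemma SG_belowD m x y : SG_below m x -> SG_below m y -> SG_below m (x + y).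
Proof. by move=> mx my; rewrite -[x]scale1r; apply: SG_belowP. Qed.

Lemma SG_belowC m x y : SG_below m (x - y) -> SG_below m (y - x).
Proof.
by move=> mxy; rewrite -opprB -[- _]add0r; apply: SG_belowB (@SG_below0 m) mxy.
Qed.

Lemma SG_belowW m p x : (m <= p)%N -> SG_below m x -> SG_below p x.
Proof. by move=> mp mx g; apply: leq_trans (mx g) mp. Qed.

Lemma SG_below_in m g p : (msize p <= m)%N -> SG_below m (inS g p).
Proof. by move=> mp h; rewrite ffunE; case: eqP; rewrite ?msize0. Qed.

Lemma spanned_below_word m w g :
  (size w < m)%N -> spannedT_below m (word_vec vecT w * grpT g).
Proof. by case: m => // m; rewrite ltnS; apply: spanned_word. Qed.

Lemma spanned_below0 m : spannedT_below m 0.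
Proof. by case: m => //= m; left. Qed.

Lemma spanned_belowP m a x y : spannedT_below m x -> spannedT_below m y ->
  spannedT_below m (a *: x + y).
Proof.
by case: m => [/= -> ->|m /=]; [rewrite scaler0 addr0 | apply: spannedP].
Qed.

Lemma spanned_belowW m p x : (m <= p)%N ->
  spannedT_below m x -> spannedT_below p x.
Proof.
case: m p => [|m] [|p] //=; first by move=> _ ->; left.
by rewrite ltnS; apply: spannedW.
Qed.

Lemma spanned_below_sort m x : SG_below m x -> spannedT_below m (sort_elt x).
Proof.
move=> mx; rewrite sort_elt_sum; elim/big_rec: _ => [|g t _ mt].
  exact: spanned_below0.
rewrite -[X in spannedT_below _ (X + _)]scale1r; apply: spanned_belowP => //.
rewrite big_seq; elim/big_rec: _ => [|d u dx mu]; first exact: spanned_below0.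
apply: spanned_belowP => //; apply: spanned_below_word; rewrite size_m2s.
exact: leq_trans (msize_mdeg_lt dx) (mx g).
Qed.

Lemma abel_below m t : spannedT m t -> SG_below m.+1 (abelT t).
Proof.
elim=> [|a w g {}t wm _ IHt]; first by rewrite linear0; apply: SG_below0.
rewrite abelT_linear; apply: SG_belowP; last exact: IHt.
rewrite word_eltE abelT_in abel_word; apply: SG_below_in.
by rewrite msizeX mdeg_s2m.
Qed.

Lemma reorder_step m :
    (forall t, spannedT_below m t -> exists2 s, SG_below m s & t - sort_elt s \in I) ->
  forall t, spannedT m t ->
    exists2 s, SG_below m (s - abelT t) & t - sort_elt s \in I.
Proof.
move=> below t; elim=> [|a w g {}t wm _ [s ms Is]].
  exists 0; first by rewrite (linear0 abelT) subr0; apply: SG_below0.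
  by rewrite (linear0 sort_elt) subr0 rpred0.
have [r mr Ir] := reorder_word grpT1 grpTM grpT_vec ideal_two_sided ideal_relator w g.
have [r' mr' Ir'] := below r (spanned_belowW wm mr).
have sortX : sort_elt (inS g 'X_[s2m w]) = word_vec vecT (m2s (s2m w)) * grpT g.
  by rewrite sort_elt_in sort_monomialX word_eltE.
have abelX : abelT (word_vec vecT w * grpT g) = inS g 'X_[s2m w].
  by rewrite word_eltE abelT_in abel_word.
exists (a *: (inS g 'X_[s2m w] + r') + s).
  rewrite abelT_linear abelX scalar_subD [_ + r']addrC addrK.
  exact: SG_belowP.
rewrite sort_elt_linear scalar_subD [sort_elt (_ + _)](linearD sort_elt) /= sortX.
apply: rpredD; last exact: Is.
apply: rpredZ; have := rpredD Ir Ir'.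
by rewrite sub_chain.
Qed.

Lemma reorder_below m t :
  spannedT_below m t -> exists2 s, SG_below m s & t - sort_elt s \in I.
Proof.
elim: m t => [t ->|m IHm t mt].
  by exists 0; [apply: SG_below0 | rewrite (linear0 sort_elt) subr0 rpred0].
have [s ms Is] := reorder_step IHm mt; exists s => //.
rewrite -[s](subrK (abelT t)); apply: SG_belowD; first exact: SG_belowW ms.
exact: abel_below.
Qed.

(** Every element of degree at most m is normally ordered by its own
    abelianisation, up to lower degree. *)
(** Up to lower degree, the normal form of an element of T(V) # G is its
    abelianisation. *)
Lemma reorder_top m t : spannedT m t ->
  exists2 s, SG_below m (s - abelT t) & t - sort_elt s \in I.
Proof. exact: reorder_step (@reorder_below m) t. Qed.

Definition SG_pihomog (m : nat) (x : SG) : SG := [ffun g => pihomog mdeg m (x g)].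

Lemma SG_pihomog_homog m x : SG_pihomog m x \in SG_homog rho m.
Proof. by apply/skew_overP=> g; rewrite ffunE; apply: pihomogP. Qed.

Lemma homog_below m x : x \in SG_homog rho m -> SG_below m.+1 x.
Proof.
move=> /skew_overP hx g; have /dhomogP hom := hx g.
rewrite msizeE big_seq; apply/bigmax_leqP_seq => d dx _.
by rewrite (hom _ dx).
Qed.

Lemma homog_below0 m x : x \in SG_homog rho m -> SG_below m x -> x = 0.
Proof.
move=> /skew_overP hx mx; apply/ffunP=> g; rewrite [RHS]ffunE.
have /dhomogP hom := hx g; apply/mpolyP => d; rewrite mcoeff0.
case: (boolP (d \in msupp (x g))) => [dx|/memN_msupp_eq0//].
by have := leq_trans (msize_mdeg_lt dx) (mx g); rewrite (hom _ dx) ltnn.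
Qed.

Lemma SG_pihomog_below m x : SG_below m.+1 x -> SG_below m (x - SG_pihomog m x).
Proof.
move=> mx g; have -> : (x - SG_pihomog m x) g = x g - pihomog mdeg m (x g).
  by rewrite !ffunE.
rewrite {1}(pihomog_partitionE (mx g)) big_ord_recr /= addrK.
apply: leq_trans (msize_sum _ _ _) _; apply/bigmax_leqP_seq => d _ _.
have /dhomogP hom := pihomogP mdeg d (x g).
rewrite msizeE big_seq; apply/bigmax_leqP_seq => j jx _.
by rewrite (hom _ jx).
Qed.

Definition H_below (m : nat) (y : H) : Prop :=
  exists2 t, spannedT_below m t & y = pi t.

Lemma H_leE m (y : H) :
  (y \in @H_le k gT V rho kappa m) <-> exists2 t, spannedT m t & y = pi t.
Proof.
split=> [/H_leP[t /spanned_le mt ->]|[t mt ->]]; first by exists t.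
by apply/H_leP; exists t => //; apply/spanned_le.
Qed.

Local Notation Hfil := (H_filtered rho kappa).
Local Notation F m := (submodule (fil_deg Hfil m)).

Lemma fil_belowE m (y : F m) : (y \in @fil_below k Hfil m) <-> H_below m (val y).
Proof.
case: m y => [|m] y.
  rewrite fil_below0E; split=> [/eqP y0|[t /= -> ->]]; last by rewrite linear0.
  by exists 0 => //; rewrite y0 linear0.
by rewrite fil_belowSE; apply: H_leE.
Qed.

Lemma natural_map_subproof m (x : submodule (SG_homog rho m)) :
  pi (sort_elt (val x)) \in @H_le k gT V rho kappa m.
Proof.
apply/H_leE; exists (sort_elt (val x)) => //.
exact: (@spanned_below_sort m.+1 _ (homog_below (valP x))).
Qed.

(** The comparison map from S # G to the associated graded algebra; it lifts the
    canonical algebra surjection, but is computed on representatives by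
    sorting. *)
Definition natural_rep m (x : submodule (SG_homog rho m)) : F m :=
  Submodule (natural_map_subproof x).

Definition natural_map m (x : submodule (SG_homog rho m)) : gr_comp Hfil m :=
  gr_class (natural_rep x).

Fact natural_map_linear m : linear (@natural_map m).
Proof.
move=> a x y; rewrite /natural_map -gr_class_linear.
congr gr_class; apply: val_inj.
have -> : val (a *: natural_rep x + natural_rep y)
    = a *: val (natural_rep x) + val (natural_rep y) by exact: linearP.
rewrite /= -(linearP pi); congr (pi _).
rewrite -sort_elt_linear; congr (sort_elt _); exact: (linearP val).
Qed.
HB.instance Definition _ m := GRing.isLinear.Build k
  (submodule (SG_homog rho m)) (gr_comp Hfil m) _ (@natural_map m)
  (@natural_map_linear m).

Lemma natural_map_eqP m (x : submodule (SG_homog rho m)) (y : F m) :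
  natural_map x = gr_class y <-> H_below m (pi (sort_elt (val x)) - val y).
Proof.
have -> : pi (sort_elt (val x)) - val y = val (natural_rep x - y).
  by rewrite [RHS]raddfB.
split=> [/gr_class_eqP/fil_belowE //|].
by move=> /fil_belowE; apply: (@gr_class_eqP k Hfil m (natural_rep x) y).
Qed.

Lemma natural_map_eq0 m (x : submodule (SG_homog rho m)) :
  natural_map x = 0 <-> H_below m (pi (sort_elt (val x))).
Proof.
rewrite -(gr_class0 Hfil m).
have -> : pi (sort_elt (val x)) = pi (sort_elt (val x)) - val (0 : F m).
  by rewrite submodule_val0 subr0.
exact: natural_map_eqP.
Qed.

Lemma H_below_sort m x : SG_below m x -> H_below m (pi (sort_elt x)).
Proof. by move=> mx; exists (sort_elt x) => //; apply: spanned_below_sort. Qed.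

Lemma pi_sortB x y : pi (sort_elt x) - pi (sort_elt y) = pi (sort_elt (x - y)).
Proof. by rewrite -(raddfB pi) -(raddfB sort_elt). Qed.

Lemma H_below_sortB m (x y : SG) (z : H) :
  SG_below m (x - y) -> z = pi (sort_elt y) -> H_below m (pi (sort_elt x) - z).
Proof. by move=> mxy ->; rewrite pi_sortB; apply: H_below_sort. Qed.

Lemma natural_map_surj m (y : gr_comp Hfil m) : exists x, natural_map x = y.
Proof.
rewrite -[y]gr_reprK; have /H_leE[t mt ytE] := valP (gr_repr y).
have [s ms /pi_eqP ts] := reorder_top mt.
exists (Submodule (SG_pihomog_homog m s)); apply/natural_map_eqP.
apply: H_below_sortB (etrans ytE ts).
apply: SG_belowC; apply: SG_pihomog_below; rewrite -[s](subrK (abelT t)); apply: SG_belowD.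
  exact: SG_belowW ms.
exact: abel_below.
Qed.

Lemma pbw_natural_map_inj m (x : submodule (SG_homog rho m)) :
  pbw -> natural_map x = 0 -> x = 0.
Proof.
move=> inj /natural_map_eq0[t mt xt]; apply: val_inj; rewrite [RHS]submodule_val0.
have [s ms /pi_eqP ts] := reorder_below mt.
have /inj/subr0_eq xs : sort_elt (val x - s) \in I.
  by apply/pi_eq0; rewrite -pi_sortB; apply: (subr0P _ _).1; apply: etrans ts.
apply: (homog_below0 (valP x)).
by rewrite xs.
Qed.

(** Peel off the component of highest degree: if x sorts to zero in H then its
    top component sorts to something of lower degree. *)
Lemma natural_map_inj_pbw :
  (forall m (x : submodule (SG_homog rho m)), natural_map x = 0 -> x = 0) -> pbw.
Proof.
move=> inj x; have [m mx] : exists m, SG_below m x.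
  by exists (\max_g msize (x g))%N => g; apply: leq_bigmax.
elim: m x mx => [|m IHm] x mx Ix.
  apply/ffunP=> g; rewrite [RHS]ffunE.
  by have := mx g; rewrite leqn0 msize_poly_eq0 => /eqP.
have pix := (pi_eq0 _).1 Ix.
have [y hy rest] : exists2 y, y \in SG_homog rho m & SG_below m (x - y).
  by exists (SG_pihomog m x); [apply: SG_pihomog_homog | apply: SG_pihomog_below].
have y_below : H_below m (pi (sort_elt y)).
  rewrite -(sub_zero (pi (sort_elt y)) pix).
  rewrite pi_sortB.
  by apply: H_below_sort; apply: SG_belowC.
have y0 : y = 0.
  have /(inj m)/(congr1 val) := (natural_map_eq0 (Submodule hy)).2 y_below.
  by rewrite submodule_val0.
by apply: IHm Ix; rewrite y0 in rest; rewrite -[x]subr0.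
Qed.

Lemma sort_elt1 : sort_elt 1 = 1.
Proof.
apply/ffunP=> g; rewrite sort_eltE !ffunE; case: eqP => _; last exact: linear0.
rewrite -mpolyX0 sort_monomialX.
have -> : m2s (0 : 'X_{1..n})%MM = [::] by apply: size0nil; rewrite size_m2s mdeg0.
by rewrite /tens_word big_nil.
Qed.

Lemma natural_map1 : natural_map (gra_one (SG_graded rho)) = gra_one (assoc_graded Hfil).
Proof.
congr gr_class; apply: val_inj; rewrite /= sort_elt1; exact: rmorph1.
Qed.

(** The product of two sorted elements abelianises to the product in S # G, and
    its normal form has the same top component. *)
Lemma sort_eltM_below i j (x y : SG) :
    x \in SG_homog rho i -> y \in SG_homog rho j ->
  H_below (i + j) (pi (sort_elt (x * y)) - pi (sort_elt x) * pi (sort_elt y)).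
Proof.
move=> hx hy.
have sx := @spanned_below_sort i.+1 _ (homog_below hx).
have sy := @spanned_below_sort j.+1 _ (homog_below hy).
have [s + /pi_eqP ts] := reorder_top (spannedM grpTM grpT_vec sx sy).
have abE : abelT (sort_elt x * sort_elt y) = x * y.
  exact: etrans (abelTM _ _) (f_equal2 *%R (sort_eltK x) (sort_eltK y)).
rewrite abE => /SG_belowC xys; apply: H_below_sortB xys _.
exact: etrans (esym (rmorphM pi _ _)) ts.
Qed.

Lemma natural_mapM i j (x : submodule (SG_homog rho i)) (y : submodule (SG_homog rho j)) :
  natural_map (gra_mul (x : SG_graded rho i) (y : SG_graded rho j))
  = gra_mul (natural_map x : assoc_graded Hfil i) (natural_map y : assoc_graded Hfil j).
Proof.
rewrite [RHS]gr_mul_class; apply/natural_map_eqP.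
exact: (sort_eltM_below (valP x) (valP y)).
Qed.

Lemma pbw_drinfeld : pbw -> drinfeld_orbifold_algebra rho kappa.
Proof.
move=> inj.
have inv m : {f : {linear gr_comp Hfil m -> submodule (SG_homog rho m)}
    | cancel (@natural_map m) f & cancel f (@natural_map m)}.
  have nat_inj : injective (@natural_map m).
    move=> x y xy; apply: subr0_eq; apply: pbw_natural_map_inj => //.
    exact: etrans (raddfB (@natural_map m) x y) ((subr0P _ _).1 xy).
  have [f fK] := choice (@natural_map_surj m).
  have fK' : cancel (@natural_map m) f by move=> x; apply: nat_inj.
  have lin_f : linear f.
    move=> a x y; apply: nat_inj; rewrite fK.
    by rewrite natural_map_linear !fK.
  pose lf := GRing.isLinear.Build k _ _ _ f lin_f.
  pose f' : {linear gr_comp Hfil m -> submodule (SG_homog rho m)} :=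
    HB.pack f lf.
  by exists f'.
exists (fun m => projT1 (sig_of_sig2 (inv m))); split.
- by move=> m; case: (inv m) => f /= fK Kf; exists (@natural_map m).
- case: (inv 0%N) => f /= fK Kf.
  exact: etrans (congr1 f (esym natural_map1)) (fK _).
move=> i j x y; case: (inv i) (inv j) (inv (i + j)%N) => f fK Kf [g gK Kg] [h hK Kh] /=.
have natM := natural_mapM (f x) (g y).
have xyE := f_equal2 (@gra_mul k (assoc_graded Hfil) i j) (Kf x) (Kg y).
exact: etrans (congr1 h (esym (etrans natM xyE))) (hK _).
Qed.

End Concrete.

(** * Abstract graded isomorphisms *)

Section Retract.
Variables (k : fieldType) (U : lmodType k) (W : vectType k).
Variables (emb : {linear U -> W}) (ret : {linear W -> U}) (embK : cancel emb ret).

(** A retract of a finite-dimensional space is finite-dimensional; extending the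
    endomorphism by the identity on the complement avoids choosing a basis of
    U. *)
Lemma retract_surj_inj (f : {linear U -> U}) :
  (forall y, exists x, f x = y) -> forall x, f x = 0 -> x = 0.
Proof.
move=> surj x fx0.
pose F w : W := emb (f (ret w)) + (w - emb (ret w)).
have linF : linear F.
  move=> a u v; rewrite /F (linearP ret) (linearP f) !(linearP emb).
  by rewrite scalar_subD addrACA -scalerDr.
pose lF := GRing.isLinear.Build k W W _ F linF.
pose F' : {linear W -> W} := HB.pack F lF.
pose h := linfun F'.
have FE w : h w = F w by rewrite lfunE.
have full : limg h = fullv.
  apply/eqP; rewrite eqEsubv subvf; apply/subvP=> w _.
  have [u fu] := surj (ret w).
  (* u replaces the component of w in the image of U *)
  apply/memv_imgP; exists (emb u + (w - emb (ret w))); first exact: memvf.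
  have retE : ret (emb u + (w - emb (ret w))) = u.
    by rewrite linearD linearB /= !embK subrr addr0.
  by rewrite FE /F retE fu [emb u + _]addrC addrK addrC subrK.
have ker0 : lker h == 0%VS.
  have := limg_ker_dim h fullv; rewrite capfv full => /eqP.
  by rewrite -[X in _ == X]add0n eqn_add2r dimv_eq0.
have : emb x \in lker h by rewrite memv_ker FE /F !embK fx0 linear0 add0r subrr.
by rewrite (eqP ker0) memv0 => /eqP ex0; rewrite -[x]embK ex0 linear0.
Qed.

End Retract.

Section FiniteDimension.
Variables (k : fieldType) (gT : finGroupType) (V : vectType k).
Variable rho : lin_action gT V.
Variable kappa : {bilinear V -> V -> {ffun gT -> k^o * V}}.
Local Notation n := (\dim {:V}).
Local Notation SG := (skew_alg (sym_act rho)).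
Local Notation Hfil := (H_filtered rho kappa).

Section Coordinates.
Variable m : nat.
Local Notation exponent := (gT * 'X_{1..n < m.+1})%type.
Local Notation coord_space := {ffun exponent -> k^o}.
Local Notation piece := (submodule (SG_homog rho m)).

Definition homog_coord (x : piece) : coord_space :=
  [ffun p : exponent => ((val x : SG) p.1)@_(val p.2)].

Fact homog_coord_linear : linear homog_coord.
Proof.
move=> a x y; apply/ffunP=> p; rewrite [LHS]ffunE.
have coefP (u v : SG) : ((a *: u + v) p.1)@_(val p.2)
    = a * (u p.1)@_(val p.2) + (v p.1)@_(val p.2).
  by rewrite !ffunE mcoeffD mcoeffZ.
by apply: etrans (coefP _ _) _; rewrite !ffunE.
Qed.
HB.instance Definition _ :=
  GRing.isLinear.Build k piece coord_space _ homog_coord homog_coord_linear.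

Definition coord_homog_fun (w : coord_space) : SG :=
  [ffun g => \sum_(d : 'X_{1..n < m.+1} | mdeg d == m) w (g, d) *: 'X_[d]].

Lemma coord_homog_subproof w : coord_homog_fun w \in SG_homog rho m.
Proof.
apply/skew_overP=> g; rewrite ffunE rpred_sum // => d dm.
by rewrite rpredZ // unfold_in /sym_homog dhomogX.
Qed.

Definition coord_homog (w : coord_space) : piece :=
  Submodule (coord_homog_subproof w).

Fact coord_homog_linear : linear coord_homog.
Proof.
move=> a u v; apply: val_inj.
have -> : val (a *: coord_homog u + coord_homog v)
    = a *: val (coord_homog u) + val (coord_homog v) by exact: (linearP val).
apply/ffunP=> g; rewrite !ffunE scaler_sumr -big_split; apply: eq_bigr => d _ /=.
by rewrite !ffunE scalerDl scalerA.
Qed.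
HB.instance Definition _ :=
  GRing.isLinear.Build k coord_space piece _ coord_homog coord_homog_linear.

Lemma homog_coordK : cancel homog_coord coord_homog.
Proof.
move=> x; apply: val_inj; apply/ffunP=> g; rewrite ffunE.
have /skew_overP/(_ g) hx := valP x.
rewrite [RHS](mpolywE (homog_below (valP x) g)).
rewrite [RHS](bigID (fun d => mdeg (val d) == m)) /=.
rewrite [X in _ = _ + X]big1 ?addr0 => [|d /negPf dm].
  by apply: eq_bigr => d _; rewrite ffunE.
by rewrite (dhomog_nemf_coeff hx) ?dm // scale0r.
Qed.

End Coordinates.

(** The given isomorphism need not be the natural map. It only serves to turn
    the natural surjection into a surjective endomorphism of a
    finite-dimensional component, which is then injective. *)
Lemma drinfeld_pbw : drinfeld_orbifold_algebra rho kappa -> pbw rho kappa.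
Proof.
move=> [f [f_bij _ _]]; apply: natural_map_inj_pbw => m x x0.
pose fm : gr_comp Hfil m -> submodule (SG_homog rho m) := f m.
have fm_lin : linear fm by exact: (linearP (f m)).
pose endo y := fm (natural_map kappa y).
have endo_lin : linear endo.
  move=> a y z.
  have natP := @natural_map_linear k gT V rho kappa m a y z.
  exact: etrans (congr1 fm natP) (fm_lin _ _ _).
pose lin_mixin := GRing.isLinear.Build k _ _ _ endo endo_lin.
pose endo' : {linear submodule (SG_homog rho m) -> submodule (SG_homog rho m)} :=
  HB.pack endo lin_mixin.
apply: (retract_surj_inj (@homog_coordK m) (f := endo')) => [y|].
  have [f' fK f'K] := f_bij m.
  have [z zE] := natural_map_surj (f' y).
  by exists z; apply: etrans (congr1 fm zE) (f'K y).
exact: etrans (congr1 fm x0) (raddf0 (f m)).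
Qed.

End FiniteDimension.

(** * The four conditions *)

Section Criterion.
Variables (k : fieldType) (gT : finGroupType) (V : vectType k).
Variable rho : lin_action gT V.
Variable kappa : {bilinear V -> V -> {ffun gT -> k^o * V}}.
Local Notation n := (\dim {:V}).
Local Notation e := (vbasis {:V}).
Local Notation T := (tens_alg V).
Local Notation S := (sym_alg V).
Local Notation TG := (skew_alg (tens_act rho)).
Local Notation SG := (skew_alg (sym_act rho)).
Local Notation inT := (skew_in (tens_act rho)).
Local Notation inS := (skew_in (sym_act rho)).
Local Notation vec := (vecT rho).
Local Notation grp := (grpT rho).
Local Notation I := (@ideal_gen k TG (@H_rel k gT V rho kappa)).

(** The quadratic symmetrisation, sending uv to u v + v u. Second derivatives at
    the origin extract the coefficients without a case distinction between
    squares and mixed terms. *)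
Definition symmetrise (p : S) : T :=
  \sum_(i < n) \sum_(j < n)
    (mderiv j (mderiv i p))@_0%MM *: (tens_gen e`_i * tens_gen e`_j).

Fact symmetrise_linear : linear symmetrise.
Proof.
move=> a p q; rewrite /symmetrise scaler_sumr -big_split; apply: eq_bigr => i _.
rewrite scaler_sumr -big_split; apply: eq_bigr => j _ /=.
by rewrite !(mderivD, mderivZ) mcoeffD mcoeffZ scalerDl scalerA.
Qed.
HB.instance Definition _ := GRing.isLinear.Build k S T _ symmetrise symmetrise_linear.

Lemma mderiv_sym_gen i v : mderiv i (sym_gen v) = (coord e i v)%:MP.
Proof.
rewrite /sym_gen linear_sum (bigD1 i) //= big1 ?addr0 => [|j /negPf ji].
  rewrite mderivZ mderivX mnm1E eqxx scale1r.
  by rewrite -{1}[U_(i)%MM]add0m addmK mpolyX0 -mul_mpolyC mulr1.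
by rewrite mderivZ mderivX mnm1E ji scale0r scaler0.
Qed.

Lemma mderiv2_sym_gen i j u v :
  (mderiv j (mderiv i (sym_gen u * sym_gen v)))@_0%MM
  = coord e i u * coord e j v + coord e i v * coord e j u.
Proof.
rewrite mderivM !mderiv_sym_gen mderivD !mderivM !mderiv_sym_gen !mderivC.
rewrite mul0r mulr0 add0r addr0 -!mpolyCM mcoeffD !mcoeffC eqxx !mulr1.
by rewrite [X in _ + X]mulrC.
Qed.

Lemma symmetrise_prod u v : symmetrise (sym_gen u * sym_gen v)
  = tens_gen u * tens_gen v + tens_gen v * tens_gen u.
Proof.
have tensE x : tens_gen x = \sum_(i < n) coord e i x *: tens_gen e`_i.
  by apply: eq_bigr => i _; rewrite tens_gen_basis.
rewrite (tensE u) (tensE v) sum_scale_sym.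
by apply: eq_bigr => i _; apply: eq_bigr => j _; rewrite mderiv2_sym_gen.
Qed.

(** The left-hand side of the condition in S(V), written out over the three
    cyclic permutations. *)
Definition quadratic_part (g : gT) (x y z : V) : S :=
  sym_gen (kappaL kappa g y z) * (sym_gen x - sym_act rho g (sym_gen x))
  + sym_gen (kappaL kappa g z x) * (sym_gen y - sym_act rho g (sym_gen y))
  + sym_gen (kappaL kappa g x y) * (sym_gen z - sym_act rho g (sym_gen z)).

Lemma sym_gen_move g x : sym_gen x - sym_act rho g (sym_gen x) = sym_gen (x - rho g x).
Proof. rewrite linearB; congr (_ - _); exact: sym_act_gen. Qed.

Lemma vecTM u v : vec u * vec v = inT 1%g (tens_gen u * tens_gen v).
Proof. by rewrite /vecT skew_inM mulg1 alg_act1. Qed.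

Lemma sym_prodE u v : sym_prod vec u v = inT 1%g (symmetrise (sym_gen v * sym_gen u)).
Proof.
rewrite symmetrise_prod; apply: etrans (f_equal2 +%R (vecTM u v) (vecTM v u)) _.
exact: etrans (addrC _ _) (esym (linearD (inT 1%g) _ _)).
Qed.

Lemma quadratic_sum x y z :
  \sum_g (sym_prod vec (x - rho g x) (kappa y z g).2
          + sym_prod vec (y - rho g y) (kappa z x g).2
          + sym_prod vec (z - rho g z) (kappa x y g).2) * grp g
  = \sum_g inT g (symmetrise (quadratic_part g x y z)).
Proof.
apply: eq_bigr => g _; rewrite !sym_prodE -!linearD inT_mul_grp.
by rewrite /quadratic_part !sym_gen_move.
Qed.

Lemma lower_partE x q g : lower_part rho kappa x q g
  = (\sum_h kappaC kappa (g * h^-1)%g (x + rho h x) (q h).2,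
     \sum_h kappaL kappa (g * h^-1)%g (x + rho h x) (q h).2
     + ((q g).1 *: (x - rho g x)) *+ 2).
Proof.
rewrite /lower_part !ffunE sum_ffunE.
have -> : \sum_h [ffun g0 => kappa (x + rho h x) (q h).2 (g0 * h^-1)%g] g
    = \sum_h kappa (x + rho h x) (q h).2 (g * h^-1)%g.
  by apply: eq_bigr => h _; rewrite ffunE.
rewrite [LHS]surjective_pairing /= addr0.
congr (_, _ + _).
  exact: (raddf_sum (@fst _ _)).
exact: (raddf_sum (@snd _ _)).
Qed.

Lemma quadratic_Alt g (v : 'I_3 -> V) :
  \sum_(s in Alt 'I_3)
    sym_gen (kappaL kappa g (v (s 1)) (v (s 2)))
    * (sym_gen (v (s 0)) - sym_act rho g (sym_gen (v (s 0))))
  = quadratic_part g (v 0) (v 1) (v 2).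
Proof.
exact: (sum_Alt3 (fun a b c => sym_gen (kappaL kappa g (v b) (v c))
  * (sym_gen (v a) - sym_act rho g (sym_gen (v a))))).
Qed.

Lemma lower_Alt g (v : 'I_3 -> V) :
  lower_jacobiator rho kappa (v 0) (v 1) (v 2) g = 0 <->
  \sum_(s in Alt 'I_3) \sum_(h : gT)
    kappaL kappa (g * h^-1)%g (v (s 0) + rho h (v (s 0)))
      (kappaL kappa h (v (s 1)) (v (s 2)))
  = (\sum_(s in Alt 'I_3)
       kappaC kappa g (v (s 1)) (v (s 2)) *: (rho g (v (s 0)) - v (s 0))) *+ 2
  /\ \sum_(s in Alt 'I_3) \sum_(h : gT)
    kappaC kappa (g * h^-1)%g (v (s 0) + rho h (v (s 0)))
      (kappaL kappa h (v (s 1)) (v (s 2))) = 0.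
Proof.
rewrite (sum_Alt3 (fun a b c => \sum_h kappaL kappa (g * h^-1)%g (v a + rho h (v a))
   (kappaL kappa h (v b) (v c)))).
rewrite (sum_Alt3 (fun a b c => kappaC kappa g (v b) (v c) *: (rho g (v a) - v a))).
rewrite (sum_Alt3 (fun a b c => \sum_h kappaC kappa (g * h^-1)%g (v a + rho h (v a))
   (kappaL kappa h (v b) (v c)))).
rewrite /lower_jacobiator.
have -> (q1 q2 q3 : {ffun gT -> k^o * V}) : (q1 + q2 + q3) g = q1 g + q2 g + q3 g.
  by rewrite !ffunE.
rewrite !lower_partE -!(opprB (v _)) !scalerN.
set D0 := _ *: _; set D1 := _ *: (v 1 - _); set D2 := _ *: (v 2 - _).
set L0 := \sum_h kappaL _ _ (v 0 + _) _; set L1 := \sum_h kappaL _ _ (v 1 + _) _.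
set L2 := \sum_h kappaL _ _ (v 2 + _) _.
set C0 := \sum_h kappaC _ _ (v 0 + _) _; set C1 := \sum_h kappaC _ _ (v 1 + _) _.
set C2 := \sum_h kappaC _ _ (v 2 + _) _.
have LE : (L0 + D0 *+ 2) + (L1 + D1 *+ 2) + (L2 + D2 *+ 2)
    = (L0 + L1 + L2) - (- D0 - D1 - D2) *+ 2.
  rewrite -mulNrn !opprD !opprK !mulrnDl.
  by rewrite [L0 + _ + (L1 + _)]addrACA [LHS]addrACA.
split=> [E|[/subr0P EL EC]].
  split; last exact: (congr1 fst E).
  by apply/subr0P; rewrite -LE; exact: (congr1 snd E).
rewrite -LE in EL.
by congr (_, _).
Qed.

(** Words of length at most 1 are sorted. *)
Lemma sort_abel1 t : spanned vec grp 1 t -> sort_elt (abelT t) = t.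
Proof.
elim=> [|a w g {}t w1 _ IHt].
  exact: etrans (congr1 _ (raddf0 (@abelT _ _ _ rho))) (raddf0 (@sort_elt _ _ _ rho)).
have wE : sort_elt (abelT (word_vec vec w * grp g)) = word_vec vec w * grp g.
  rewrite word_eltE abelT_in sort_elt_in abel_word sort_monomialX m2s_s2m //.
  by case: w w1 => [|i [|j w]].
rewrite abelT_linear sort_elt_linear.
exact: (f_equal2 (fun u v => a *: u + v) wE IHt).
Qed.

Lemma affine_eq0 (q : k^o * V) : q.1%:A + sym_gen q.2 = 0 :> S -> q = 0.
Proof.
case: q => c u /= q0; congr (_, _).
  have := congr1 (mcoeff 0%MM) q0; rewrite mcoeffD mcoeff0 alg_mpolyC mcoeffC eqxx mulr1.
  rewrite /sym_gen linear_sum /= big1 ?addr0 // => i _.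
  by rewrite mcoeffZ mcoeffX mnm1_eq0 mulr0.
rewrite (coord_vbasis (memvf u)) big1 // => i _.
have := congr1 (mcoeff U_(i)%MM) q0; rewrite mcoeffD mcoeff0 alg_mpolyC mcoeffC.
rewrite mnm1_eq0 mulr0 add0r /sym_gen linear_sum /= (bigD1 i) //=.
rewrite mcoeffZ mcoeffXU eqxx mulr1 big1 ?addr0 => [->|j /negPf ji]; first exact: scale0r.
by rewrite mcoeffZ mcoeffXU ji mulr0.
Qed.

Lemma abelT_param q g : abelT (param_elt vec grp q) g = (q g).1%:A + sym_gen (q g).2.
Proof.
rewrite abelTE param_eltE sum_skew_inE.
apply: etrans (raddfD (@abel k V) _ _) _; congr (_ + _); last exact: abel_gen.
exact: rmorph_alg.
Qed.

(** In degree at most 1 the algebra H has no relations. *)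
Lemma pbw_param q : pbw rho kappa -> param_elt vec grp q \in I -> q = 0.
Proof.
move=> inj.
rewrite -(sort_abel1 (spanned_param_elt (grpT1 rho) (grpTM rho) (grpT_vec rho) q)).
move=> /inj q0; apply/ffunP=> g; rewrite [RHS]ffunE; apply: affine_eq0.
by rewrite -abelT_param q0 ffunE.
Qed.

Lemma abel_symmetrise_prod u v :
  abel (symmetrise (sym_gen u * sym_gen v)) = (sym_gen u * sym_gen v) *+ 2.
Proof.
rewrite symmetrise_prod; apply: etrans (raddfD (@abel k V) _ _) _.
rewrite mulr2n; congr (_ + _); apply: etrans (rmorphM (@abel k V) _ _) _.
  exact: (f_equal2 *%R (abel_gen u) (abel_gen v)).
rewrite mulrC; exact: (f_equal2 *%R (abel_gen u) (abel_gen v)).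
Qed.

Lemma abel_symmetrise_quadratic g x y z :
  abel (symmetrise (quadratic_part g x y z)) = quadratic_part g x y z *+ 2.
Proof.
pose doubled p := abel (symmetrise p) = p *+ 2.
have doubledD p q : doubled p -> doubled q -> doubled (p + q).
  move=> dp dq; apply: etrans (congr1 _ (raddfD symmetrise p q)) _.
  apply: etrans (raddfD (@abel k V) _ _) _.
  exact: etrans (f_equal2 +%R dp dq) (esym (mulrnDl 2 p q)).
rewrite /quadratic_part !sym_gen_move.
by apply: (doubledD); [apply: (doubledD)|]; apply: abel_symmetrise_prod.
Qed.

Lemma quadratic_part_homog g x y z : quadratic_part g x y z \in sym_homog 2.
Proof.
have prod_homog u v : sym_gen u * sym_gen v \in @sym_homog k V 2.
  exact: (@dhomogM _ _ _ 1 _ 1 _ (sym_homog_gen u) (sym_homog_gen v)).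
by rewrite /quadratic_part !sym_gen_move !rpredD.
Qed.

Lemma ideal_grpr t g : t * grp g \in I -> t \in I.
Proof.
move=> tI; rewrite -[t]mulr1 -(grpT1 rho) -(mulgV g) (grpTM rho) mulrA.
exact: ideal_gen_mulr.
Qed.

Lemma pbw_invariant : pbw rho kappa -> kappa_invariant rho kappa.
Proof.
move=> inj h v' w'.
pose v := rho h^-1%g v'; pose w := rho h^-1%g w'.
have vE : rho h v = v' by rewrite /v -lin_actM mulgV lin_act1.
have wE : rho h w = w' by rewrite /w -lin_actM mulgV lin_act1.
have H1 := ideal_gen_mull (grp h) (ideal_relator rho kappa v w).
have H2 := ideal_gen_mulr (grp h) (ideal_relator rho kappa v' w').
rewrite (grp_relator kappa (grpTM rho) (grpT_vec rho)) vE wE in H1.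
have := rpredB H2 H1; rewrite -mulrBl => /ideal_grpr.
rewrite /relator (sub_cancel (_ - _)) -linearB => /(pbw_param inj)/subr0_eq.
exact.
Qed.
Local Notation rel := (relator kappa vec grp).
Local Notation quadratic_sum_elt x y z :=
  (\sum_g (sym_prod vec (x - rho g x) (kappa y z g).2
          + sym_prod vec (y - rho g y) (kappa z x g).2
          + sym_prod vec (z - rho g z) (kappa x y g).2) * grp g).
Local Notation relator_sum x y z :=
  (\sum_g rel (x + rho g x) (kappa y z g).2 * grp g
   + \sum_g rel (y + rho g y) (kappa z x g).2 * grp g
   + \sum_g rel (z + rho g z) (kappa x y g).2 * grp g).
Local Notation lower := (lower_jacobiator rho kappa).

Lemma ideal_jacobiator x y z : jacobiator kappa vec grp x y z \in I.
Proof.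
rewrite jacobiator_relators.
have relI u v w : vec u * rel v w - rel v w * vec u \in I.
  apply: rpredB; first exact/ideal_gen_mull/ideal_relator.
  exact/ideal_gen_mulr/ideal_relator.
by rewrite rpredN; apply: rpredD; [apply: rpredD|]; apply: relI.
Qed.

Lemma ideal_relator_sum x y z : relator_sum x y z \in I.
Proof.
have sumI (F : gT -> V) (f : gT -> V) : \sum_g rel (F g) (f g) * grp g \in I.
  by apply: rpred_sum => g _; apply/ideal_gen_mulr/ideal_relator.
by apply: rpredD; [apply: rpredD|]; apply: sumI.
Qed.

Lemma twice_jacobiator_lower x y z :
  quadratic_sum_elt x y z + param_elt vec grp (lower x y z) \in I.
Proof.
have JI : jacobiator kappa vec grp x y z *+ 2 \in I.
  by rewrite mulr2n; apply: rpredD; apply: ideal_jacobiator.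
rewrite (twice_jacobiator kappa (grpTM rho) (grpT_vec rho)) in JI.
have := rpredB JI (ideal_relator_sum x y z).
by rewrite sub_middle.
Qed.

Lemma spanned_quadratic_sum x y z : spanned vec grp 2 (quadratic_sum_elt x y z).
Proof.
have spanV v : spanned vec grp 1 (vec v) by apply: (spanned_vec vec (grpT1 rho)).
have spanM := spannedM (grpTM rho) (grpT_vec rho).
have span_sym u v : spanned vec grp 2 (sym_prod vec u v).
  by apply: spannedD; apply: (spanM 1%N 1%N); apply: spanV.
apply: spanned_sum => g; apply: (spanM 2%N 0%N); last exact: spanned_grp.
by apply: spannedD; [apply: spannedD|].
Qed.

Lemma quadratic_sum0 x y z :
  (forall g, quadratic_part g x y z = 0) -> quadratic_sum_elt x y z = 0.
Proof.
move=> quad0; rewrite quadratic_sum big1 // => g _; rewrite quad0.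
exact: etrans (congr1 _ (raddf0 symmetrise)) (raddf0 (inT g)).
Qed.

Lemma abelT_quadratic_sum x y z g :
  abelT (quadratic_sum_elt x y z) g = quadratic_part g x y z *+ 2.
Proof. by rewrite quadratic_sum abelTE sum_skew_inE abel_symmetrise_quadratic. Qed.

Lemma quadratic_sum_homog x y z :
  abelT (quadratic_sum_elt x y z) \in SG_homog rho 2.
Proof.
apply/skew_overP=> g; rewrite abelT_quadratic_sum.
by rewrite mulr2n; apply: rpredD; apply: quadratic_part_homog.
Qed.

Hypothesis two_neq0 : (2%:R : k) != 0.

(** The right-hand side of [twice_jacobiator] vanishes in H. Its abelianisation
    in degree 2 is twice the quadratic part, so the latter is zero, and with it
    its symmetrisation; what remains has degree at most 1. *)
Lemma pbw_conditions x y z : pbw rho kappa ->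
  (forall g, quadratic_part g x y z = 0) /\ lower x y z = 0.
Proof.
move=> inj; have tI := twice_jacobiator_lower x y z.
set Q := \sum_g _ in tI; set P := param_elt _ _ _ in tI.
have spanP : spanned vec grp 1 P.
  exact: (spanned_param_elt (grpT1 rho) (grpTM rho) (grpT_vec rho)).
have spanQ : spanned vec grp 2 Q := spanned_quadratic_sum x y z.
have spanQP : spanned vec grp 2 (Q + P).
  exact: spannedD spanQ (spannedW (isT : 1 <= 2)%N spanP).
have [s sQP sI] := reorder_top kappa spanQP.
(* the sorted element of s lies in the ideal together with Q + P *)
have s0 : s = 0.
  apply: inj; have := rpredB tI sI; rewrite opprB addrC subrK; exact.
have abelQ : abelT Q = 0.
  apply: (homog_below0 (quadratic_sum_homog x y z)).
  have belowP := abel_below spanP.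
  have belowQP : SG_below 2 (abelT (Q + P)).
    by have := SG_belowC sQP; rewrite s0 subr0.
  have := SG_belowB belowQP belowP.
  have -> : abelT (Q + P) = abelT Q + abelT P by exact: raddfD.
  by rewrite addrK.
have quad0 g : quadratic_part g x y z = 0.
  have := abelT_quadratic_sum x y z g; rewrite -/Q abelQ ffunE => /esym/eqP.
  by rewrite -scaler_nat scaler_eq0 (negPf two_neq0) => /eqP.
split=> //; apply: (pbw_param inj); rewrite -/P.
have Q0 : Q = 0 by apply: quadratic_sum0.
have QI : Q \in I by rewrite Q0 rpred0.
by have := rpredB tI QI; rewrite sub_left.
Qed.

Lemma conditions_pbw : (forall v, kappa v v = 0) -> kappa_invariant rho kappa ->
    (forall g x y z, quadratic_part g x y z = 0) ->
    (forall x y z, lower x y z = 0) ->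
  pbw rho kappa.
Proof.
move=> alt inv quad0 lower0; apply: (normal_form_pbw two_neq0 alt) => [h v w|x y z].
  by apply: etrans (grp_relator kappa (grpTM rho) (grpT_vec rho) h v w) _; rewrite inv.
apply: etrans (twice_jacobiator kappa (grpTM rho) (grpT_vec rho) x y z) _.
apply: sandwich0; first by apply: quadratic_sum0 => g; apply: quad0.
by rewrite lower0; apply: (raddf0 (param_elt vec grp)).
Qed.

End Criterion.

(* The vectors v_1, v_2, v_3 are v 0, v 1, v 2 for v : 'I_3 -> V. *)
Theorem theorem3p1 (k : fieldType) (char_k : 2%N \notin [pchar k])
    (gT : finGroupType) (V : vectType k) (rho : lin_action gT V)
    (kappa : {bilinear V -> V -> {ffun gT -> k^o * V}})
    (kappa_alt : forall v : V, kappa v v = 0) :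
  drinfeld_orbifold_algebra rho kappa <->
  kappa_invariant rho kappa /\
  forall (g : gT) (v : 'I_3 -> V),
    [/\ \sum_(s in Alt 'I_3)
          sym_gen (kappaL kappa g (v (s 1)) (v (s 2)))
          * (sym_gen (v (s 0)) - sym_act rho g (sym_gen (v (s 0)))) = 0,
        \sum_(s in Alt 'I_3) \sum_(h : gT)
          kappaL kappa (g * h^-1)%g (v (s 0) + rho h (v (s 0)))
            (kappaL kappa h (v (s 1)) (v (s 2)))
        = (\sum_(s in Alt 'I_3)
             kappaC kappa g (v (s 1)) (v (s 2))
             *: (rho g (v (s 0)) - v (s 0))) *+ 2
      & \sum_(s in Alt 'I_3) \sum_(h : gT)
          kappaC kappa (g * h^-1)%g (v (s 0) + rho h (v (s 0)))
            (kappaL kappa h (v (s 1)) (v (s 2))) = 0].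
Proof.
have two_neq0 : (2%:R : k) != 0 by move: char_k; rewrite inE.
split=> [/drinfeld_pbw inj|[inv cond]].
  split=> [|g v]; first exact: pbw_invariant.
  have [quad0 low0] := pbw_conditions two_neq0 (v 0) (v 1) (v 2) inj.
  have [iii iv] : _ /\ _ := (lower_Alt rho kappa g v).1 ltac:(by rewrite low0 ffunE).
  by split; [rewrite quadratic_Alt quad0 | exact: iii | exact: iv].
pose v (x y z : V) (i : 'I_3) := nth 0 [:: x; y; z] i.
apply/pbw_drinfeld/conditions_pbw => // [g x y z|x y z].
  by have [ii _ _] := cond g (v x y z); rewrite quadratic_Alt in ii.
apply/ffunP=> g; rewrite [RHS]ffunE; have [_ iii iv] := cond g (v x y z).
exact: ((lower_Alt rho kappa g (v x y z)).2 (conj iii iv)).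
Qed.
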